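(* The consequence relation $\phi_1,\dots,\phi_n\models_\Sigma\phi$ (of the three-valued sequential first-order logic $\mathsf{L_{sfol}}(\Sigma)$ over partial $\Sigma$-algebras) is semi-computable.
   Context: Algebras. $\Sigma$ is a signature that contains one or more partial function symbols and a constant symbol; function symbols are marked as total or partial. A partial $\Sigma$-algebra ($\Sigma$-structure) $A$ has a non-empty domain $|A|$, a value in $|A|$ for each constant, a total operation for each total function symbol, and a (possibly) partial operation for each partial function symbol. Formulae. $\mathsf{L_{sfol}}(\Sigma)$ is built from $\mathsf T,\mathsf F$ and atoms $t=_{\mathsf p}r$ ($t,r$ $\Sigma$-terms, possibly with variables) using $\neg$, the short-circuit connectives $\vee_\ell,\wedge_\ell,\to_\ell$, and quantifiers $\forall_{\mathsf p},\exists_{\mathsf p}$, where $\phi\wedge_\ell\psi$ means $\neg(\neg\phi\vee_\ell\neg\psi)$, $\phi\to_\ell\psi$ means $\neg\phi\vee_\ell\psi$, and $\exists_{\mathsf p}x.\phi$ means $\neg\forall_{\mathsf p}x.\neg\phi$. Semantics. A valuation $\sigma$ assigns elements of $|A|$ to variables; it extends to terms strictly ($\sigma(f(t_1,\dots,t_k))$ is defined iff all $\sigma(t_i)$ are defined and $f$ is defined on them). $\sigma[a/x]$ is $\sigma$ modified to send $x$ to $a$. Satisfaction $A,\sigma\models\phi$ (also written $A,\sigma\models_\Sigma\phi$) and denial satisfaction $A,\sigma\models^-\phi$ are defined inductively by: - $A,\sigma\models\mathsf T$; $A,\sigma\models^-\mathsf F$ (and $\mathsf T$ is never denied, $\mathsf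 F$ never satisfied); - $A,\sigma\models t=_{\mathsf p}r$ iff $\sigma(t),\sigma(r)$ are both defined and equal; $A,\sigma\models^- t=_{\mathsf p}r$ iff both are defined and different; - $A,\sigma\models\neg\phi$ iff $A,\sigma\models^-\phi$; $A,\sigma\models^-\neg\phi$ iff $A,\sigma\models\phi$; - $A,\sigma\models\phi_1\vee_\ell\phi_2$ iff $A,\sigma\models\phi_1$, or both $A,\sigma\models^-\phi_1$ and $A,\sigma\models\phi_2$; $A,\sigma\models^-\phi_1\vee_\ell\phi_2$ iff $A,\sigma\models^-\phi_1$ and $A,\sigma\models^-\phi_2$; - $A,\sigma\models\forall_{\mathsf p}x.\phi$ iff $A,\sigma[a/x]\models\phi$ for all $a\in|A|$; $A,\sigma\models^-\forall_{\mathsf p}x.\phi$ iff $A,\sigma[a/x]\models^-\phi$ for some $a\in|A|$ and $A,\sigma[b/x]\models\phi\vee_\ell\neg\phi$ for all $b\in|A|$. Consequence. For formulae $\phi_1,\dots,\phi_n,\phi$ of $\mathsf{L_{sfol}}(\Sigma)$, $\phi_1,\dots,\phi_n\models_\Sigma\phi$ iff for each $\Sigma$-structure $A$: if for all valuations $\sigma$ into $|A|$ we have $A,\sigma\models_\Sigma\phi_1,\dots,A,\sigma\models_\Sigma\phi_n$, then for all valuations $\sigma$ into $|A|$ we have $A,\sigma\models_\Sigma\phi$. Semi-computable means recursively enumerable.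
   Formalization: The signature is assumed to be effectively presented (symbols, arities and total/partial marks decidable; automatic for finite signatures); without this, marking f_n total iff n is outside the halting set makes consequence non-r.e. *)

(* Defs.v *)
From mathcomp Require Import all_boot.

Set Implicit Arguments.
Unset Strict Implicit.
Unset Printing Implicit Defensive.

(** * Partial recursive functions *)

Inductive recfun : nat -> Type :=
| RZero n : recfun n
| RSucc : recfun 1
| RProj n : 'I_n -> recfun n
| RComp m n : recfun m -> ('I_m -> recfun n) -> recfun n
| RPrec n : recfun n -> recfun n.+2 -> recfun n.+1
| RMu n : recfun n.+1 -> recfun n.

(* [computes p v y]: p is defined at v, with value y.  The recursion variable
   of [RPrec] and the search variable of [RMu] are the first argument; the
   witness [h] of [RPrec] is the course of values of the recursion. *)
Fixpoint computes n (p : recfun n) : n.-tuple nat -> nat -> Prop :=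
  match p in recfun n return n.-tuple nat -> nat -> Prop with
  | RZero _ => fun _ y => y = 0
  | RSucc => fun v y => y = (thead v).+1
  | RProj _ i => fun v y => y = tnth v i
  | @RComp m _ f g => fun v y =>
      exists w : m.-tuple nat,
        (forall i, computes (g i) v (tnth w i)) /\ computes f w y
  | @RPrec n f g => fun v y =>
      let k := thead v in
      let u : n.-tuple nat := [tuple of behead v] in
      exists h : nat -> nat,
        [/\ computes f u (h 0),
            forall i, i < k -> computes g [tuple of i :: h i :: u] (h i.+1)
          & y = h k]
  | @RMu n f => fun v y =>
      computes f [tuple of y :: v] 0 /\
      forall i, i < y -> exists z, computes f [tuple of i :: v] z.+1
  end.

Definition computable (f : nat -> nat) : Prop :=
  exists p : recfun 1, forall n, computes p [tuple n] (f n).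

(* Recursively enumerable: the domain of a partial recursive function. *)
Definition semi_computable (P : nat -> Prop) : Prop :=
  exists p : recfun 1, forall n, P n <-> exists y, computes p [tuple n] y.

(** * Signatures and partial algebras *)

Record signature := Signature {
  const_sym : countType;
  fun_sym : countType;
  arity : fun_sym -> nat;
  arity_gt0 : forall f, 0 < arity f;
  is_total : pred fun_sym (* marked as total; partial otherwise *)
}.

(* Identifying symbols with their numbers [pickle c], [pickle f], one can
   decide which numbers are constants and function symbols, and compute the
   arity and the mark of the latter.  Being positive, the arity tells function
   symbols from other numbers.  Finite signatures are always effective, see
   [finite_effective]. *)
Definition effective (S : signature) : Prop :=
  [/\ computable (fun n => isSome (pickle_inv n : option (const_sym S)) : nat),
      computable (fun n => if pickle_inv n is Some f then @arity S f else 0)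
    & computable
        (fun n => if pickle_inv n is Some f then @is_total S f : nat else 0)].

Record algebra (S : signature) := Algebra {
  domain :> Type;
  domain_inh : inhabited domain;
  const_val : const_sym S -> domain;
  fun_val : forall f : fun_sym S, (arity f).-tuple domain -> option domain;
  fun_val_total : forall f v, is_total f -> isSome (@fun_val f v)
}.

(** * Syntax *)

Inductive term (S : signature) : Type :=
| Var of nat
| Const of const_sym S
| App (f : fun_sym S) of ('I_(arity f) -> term S).

Inductive formula (S : signature) : Type :=
| Tr
| Fa
| Eqp of term S & term S
| Neg of formula S
| Orl of formula S & formula S
| Allp of nat & formula S.

Arguments Var {S} _.
Arguments Const {S} _.
Arguments App {S} f _.
Arguments Tr {S}.
Arguments Fa {S}.

Definition Andl S (phi psi : formula S) := Neg (Orl (Neg phi) (Neg psi)).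
Definition Impl S (phi psi : formula S) := Orl (Neg phi) psi.
Definition Exp S x (phi : formula S) := Neg (Allp x (Neg phi)).

(** * Semantics *)

Definition upd (D : Type) (s : nat -> D) (x : nat) (a : D) : nat -> D :=
  fun y => if y == x then a else s y.

(* [denotes s t a]: the value of t under s is defined and equal to a. *)
Fixpoint denotes S (A : algebra S) (s : nat -> A) (t : term S) (a : A) : Prop :=
  match t with
  | Var x => s x = a
  | Const c => const_val A c = a
  | App f ts =>
      exists v : (arity f).-tuple A,
        (forall i, denotes s (ts i) (tnth v i)) /\ fun_val v = Some a
  end.

Fixpoint sat S (A : algebra S) (s : nat -> A) (phi : formula S) : Prop :=
  match phi with
  | Tr => True
  | Fa => False
  | Eqp t r => exists a, denotes s t a /\ denotes s r a
  | Neg phi => deny s phi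
  | Orl phi psi => sat s phi \/ deny s phi /\ sat s psi
  | Allp x phi => forall a, sat (upd s x a) phi
  end
with deny S (A : algebra S) (s : nat -> A) (phi : formula S) : Prop :=
  match phi with
  | Tr => False
  | Fa => True
  | Eqp t r => exists a b, [/\ denotes s t a, denotes s r b & a <> b]
  | Neg phi => sat s phi
  | Orl phi psi => deny s phi /\ deny s psi
  | Allp x phi =>
      (exists a, deny (upd s x a) phi) /\
      (* satisfaction of [Orl phi (Neg phi)], unfolded: see [deny_Allp] *)
      (forall b, sat (upd s x b) phi \/
                 deny (upd s x b) phi /\ deny (upd s x b) phi)
  end.

Lemma deny_Allp S (A : algebra S) (s : nat -> A) x (phi : formula S) :
  deny s (Allp x phi) =
  ((exists a, deny (upd s x a) phi) /\
   (forall b, sat (upd s x b) (Orl phi (Neg phi)))).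
Proof. by []. Qed.

Definition consequence S (Gamma : seq (formula S)) (phi : formula S) : Prop :=
  forall A : algebra S,
    (forall s : nat -> A, forall i, i < size Gamma ->
       sat s (nth Tr Gamma i)) ->
    forall s : nat -> A, sat s phi.

(** * Goedel numbering *)

(* Based on the bijection [CodeSeq.code : seq nat -> nat]. *)
Fixpoint code_term S (t : term S) : nat :=
  match t with
  | Var x => CodeSeq.code [:: 0; x]
  | Const c => CodeSeq.code [:: 1; pickle c]
  | App f ts =>
      CodeSeq.code
        (2 :: pickle f :: [seq code_term (ts i) | i <- enum 'I_(arity f)])
  end.

Fixpoint code_formula S (phi : formula S) : nat :=
  match phi with
  | Tr => CodeSeq.code [:: 0]
  | Fa => CodeSeq.code [:: 1]
  | Eqp t r => CodeSeq.code [:: 2; code_term t; code_term r]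
  | Neg phi => CodeSeq.code [:: 3; code_formula phi]
  | Orl phi psi => CodeSeq.code [:: 4; code_formula phi; code_formula psi]
  | Allp x phi => CodeSeq.code [:: 5; x; code_formula phi]
  end.

Definition code_sequent S (Gamma : seq (formula S)) (phi : formula S) : nat :=
  CodeSeq.code (code_formula phi :: [seq code_formula psi | psi <- Gamma]).

(** * Finite signatures are effective *)

Lemma finite_support_computable N (f : nat -> nat) :
  (forall n, N <= n -> f n = 0) -> computable f.
Proof.
elim: N f => [|N IHN] f f0.
  by exists (RZero 1) => n /=; rewrite f0.
have [n leNn|p pP] := IHN (fun n => f n.+1); first exact: f0.
have [q qP] : exists q : recfun 0, forall v, computes q v (f 0).
  elim: (f 0) => [|m [q qP]]; first by exists (RZero 0).
  exists (RComp RSucc (fun=> q)) => v /=.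
  by exists [tuple m]; split=> [i|]; rewrite ?(tnth_nth 0) ?ord1.
exists (RPrec q (RComp p (fun=> RProj ord0))) => n /=.
exists f; split=> [|i _|]; [exact: qP | | by []].
by exists [tuple i]; split=> [j|]; [rewrite ord1 | exact: pP].
Qed.

Lemma finite_effective (S : signature) :
  (exists cs : seq (const_sym S), forall c, c \in cs) ->
  (exists fs : seq (fun_sym S), forall f, f \in fs) -> effective S.
Proof.
have bnd (T : countType) (s : seq T) : (forall x, x \in s) ->
    exists N, forall n, N <= n -> pickle_inv n = None :> option T.
  move=> sP; exists (\max_(x <- s) pickle x).+1 => n ltn.
  case E: (pickle_inv n) => [x|//]; have := @pickle_invK T n.
  rewrite E /= => xn; have := @leq_bigmax_seq T s xpredT pickle x (sP x) isT.
  by rewrite xn leqNgt ltn.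
move=> [cs /bnd[N hN]] [fs /bnd[M hM]].
split; [apply: (@finite_support_computable N)|
        apply: (@finite_support_computable M)..] => n le_n;
  by rewrite ?hN ?hM.
Qed.

(* Main.v *)
From Stdlib Require List.
Require Import Defs.
From mathcomp Require Import all_boot boolp.

(* The existence of a counterexample to the consequence is expressed by the
   consistency of a set of propositional clauses over atoms
   "psi is satisfied (denied) in the environment e", "t is defined in e", "the
   names a and b denote the same element".  A name is a pair of a term and an
   environment, or a Henkin witness determined by a quantified formula, an
   environment and the role of the witness; an environment is a finite list of
   bindings of variables to names.  So no substitution and no fresh constants
   are needed, and every consistent set of literals extends to a valuation of
   all atoms, whose names modulo equality form a counterexample.

   Natural numbers are binary trees, through the pairing 2 ^ a * (2 * b + 1) of
   [CodeSeq.code], and inconsistency is the least set of trees closed under a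
   finite list of Horn clauses with computable guards.  Every such set is
   recursively enumerable: search for a derivation. *)

Set Implicit Arguments.
Unset Strict Implicit.
Unset Printing Implicit Defensive.

(** * Total recursive functions *)

(** Two features of the logic shape the atoms. A formula can be neither satisfied nor denied, so
    satisfaction and denial are separate atoms. A term can be undefined, yet its name has to denote
    something; hence equality of names says something about terms only together with definedness.
    Denial of a quantifier also requires the body to be decided everywhere, so a quantifier that is
    not denied needs a witness of its own. Premises must hold under all valuations, and the
    conclusion must fail under one. The empty environment stands for an arbitrary valuation, so
    failure is one negative literal there, while a premise is itself a literal with a clause for
    each environment. Case splits on every atom are allowed, so an unrefuted set can be completed
    one atom at a time and no normal form of refutations is needed. *)

Definition total_rec k (f : seq nat -> nat) : Prop :=
  exists p : recfun k, forall v : k.-tuple nat, computes p v (f v).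

(** Functions take plain lists, which avoids casts between tuple types. Only their values at lists
    of length [k] matter. *)
Lemma total_rec_ext k (f g : seq nat -> nat) :
  (forall v : k.-tuple nat, f v = g v) -> total_rec k f -> total_rec k g.
Proof. by move=> fg [p pP]; exists p => v; rewrite -fg. Qed.

Lemma total_rec_nth k i : i < k -> total_rec k (fun v => nth 0 v i).
Proof. by move=> lt_ik; exists (RProj (Ordinal lt_ik)) => v /=; rewrite (tnth_nth 0). Qed.

Lemma total_rec_comp m k f (gs : 'I_m -> seq nat -> nat) :
  total_rec m f -> (forall i, total_rec k (gs i)) ->
  total_rec k (fun v => f [seq gs i v | i <- enum 'I_m]).
Proof.
move=> [p pP] gsP.
(* Programs for finitely many components are chosen by induction on a list of indices, without an
   axiom of choice. *)
have [q qP] : exists q : 'I_m -> recfun k,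
    forall i v, computes (q i) v (gs i v).
  have: forall s : seq 'I_m, uniq s -> exists q : 'I_m -> recfun k,
     forall i, i \in s -> forall v : k.-tuple nat, computes (q i) v (gs i v).
    elim=> [|i s IHs] /=; first by exists (fun=> RZero k).
    move=> /andP[i_s /IHs[q qP]]; have [qi qiP] := gsP i.
    exists (fun j => if j == i then qi else q j) => j.
    by rewrite inE; case: eqP => [->|_] //=; apply: qP.
  case/(_ (enum 'I_m) (enum_uniq _)) => q qP; exists q => i.
  by apply: qP; rewrite mem_enum.
exists (RComp p q) => v /=.
exists [tuple of [seq gs i v | i <- ord_tuple m]]; split=> [i|].
  by rewrite tnth_map tnth_ord_tuple; apply: qP.
by have := pP [tuple of [seq gs i v | i <- ord_tuple m]].
Qed.

Lemma total_rec_const k n : total_rec k (fun=> n).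
Proof.
elim: n => [|n [p pP]]; first by exists (RZero k).
exists (RComp RSucc (fun=> p)) => v /=.
by exists [tuple n]; split=> [i|]; rewrite ?(tnth_nth 0) ?ord1 //=; apply: pP.
Qed.

Lemma total_rec_fun1 F k g : computable F -> total_rec k g ->
  total_rec k (fun v => F (g v)).
Proof.
move=> [p pP] gP; apply: (total_rec_ext (f := fun v => F (nth 0 [:: g v] 0))) => //.
have := @total_rec_comp 1 k (fun v => F (nth 0 v 0)) (fun=> g) _ (fun=> gP).
move=> H; apply: (total_rec_ext _ (H _)) => [v|] /=; first by rewrite enum_ordSl.
exists p => v; have := pP (nth 0 v 0); congr computes.
by apply: val_inj; case: v => [[|a []]].
Qed.

Lemma total_rec_fun2 F k g h : total_rec 2 (fun v => F (nth 0 v 0) (nth 0 v 1)) ->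
  total_rec k g -> total_rec k h -> total_rec k (fun v => F (g v) (h v)).
Proof.
move=> FP gP hP.
have := @total_rec_comp 2 k _ (fun i => if i == 0 :> nat then g else h) FP.
move=> H; apply: (total_rec_ext _ (H _)) => [v|i]; last by case: ifP.
by rewrite !enum_ordSl /= .
Qed.

Lemma total_rec_fun3 F k g h l :
  total_rec 3 (fun v => F (nth 0 v 0) (nth 0 v 1) (nth 0 v 2)) ->
  total_rec k g -> total_rec k h -> total_rec k l ->
  total_rec k (fun v => F (g v) (h v) (l v)).
Proof.
move=> FP gP hP lP.
have := @total_rec_comp 3 k _ (fun i => nth g [:: g; h; l] i) FP.
move=> H; apply: (total_rec_ext _ (H _)) => [v|]; first by rewrite !enum_ordSl.
by case=> [[|[|[]]]].
Qed.

Lemma total_rec_reindex m k f (r : nat -> nat) :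
  (forall i, i < m -> r i < k) -> total_rec m f ->
  total_rec k (fun v => f (mkseq (fun i => nth 0 v (r i)) m)).
Proof.
move=> rP fP; apply: (total_rec_ext (f := fun v =>
  f [seq nth 0 v (r (i : 'I_m)) | i <- enum 'I_m])) => [v|].
  by rewrite /mkseq -(val_enum_ord m) -map_comp.
by apply: (total_rec_comp (gs := fun i v => nth 0 v (r (i : 'I_m)))) => // i;
   apply: total_rec_nth; apply: rP.
Qed.

Lemma total_rec_rec k (N f : seq nat -> nat) (g : nat -> nat -> seq nat -> nat) :
  total_rec k N -> total_rec k f ->
  total_rec k.+2 (fun v => g (nth 0 v 0) (nth 0 v 1) (drop 2 v)) ->
  total_rec k (fun v => nat_rect _ (f v) (fun i r => g i r v) (N v)).
Proof.
move=> NP [p pP] [q qP].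
have recP : total_rec k.+1
    (fun v => nat_rect _ (f (behead v)) (fun i r => g i r (behead v)) (head 0 v)).
  exists (RPrec p q) => v /=; set u := [tuple of behead v].
  exists (nat_rect _ (f u) (fun i r => g i r u)); split; first exact: pP.
    move=> i _; have := qP [tuple of i :: nat_rect _ (f u) (fun i r => g i r u) i :: u].
    by rewrite /= drop0.
  by case: v @u => [[|a v]].
(* [RPrec] recurses on its first argument: component [0] supplies the bound [N v], the others copy
   [v]. *)
have := @total_rec_comp k.+1 k _
  (fun i v => if i == 0 :> nat then N v else nth 0 v i.-1) recP.
move=> H; apply: (total_rec_ext _ (H _)) => [v|i]; last first.
  case: eqP => // /eqP; rewrite -lt0n => i0; apply: total_rec_nth.
  by case: i i0 => [[|i]].
rewrite enum_ordSl /= -map_comp; set w := map _ _; suff -> : w = v by [].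
apply: (@eq_from_nth _ 0); first by rewrite /w size_map size_enum_ord size_tuple.
move=> i; rewrite /w size_map size_enum_ord => lt_ik.
by rewrite (nth_map (Ordinal lt_ik)) ?size_enum_ord //= nth_enum_ord.
Qed.

Definition computable2 F := total_rec 2 (fun v => F (nth 0 v 0) (nth 0 v 1)).

Lemma total_rec_nth_drop k j i : j + i < k -> total_rec k (fun v => nth 0 (drop j v) i).
Proof.
move=> ltk; apply: total_rec_ext (total_rec_nth ltk) => v.
by rewrite nth_drop.
Qed.

Lemma computable_total_rec F :
  computable F <-> total_rec 1 (fun v => F (nth 0 v 0)).
Proof.
split=> [FP|[p pP]]; first by apply: (total_rec_fun1 FP); apply: total_rec_nth.
by exists p => n; apply: (pP [tuple n]).
Qed.

Lemma computable_succ : computable succn.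
Proof. by exists RSucc. Qed.

Lemma computable2_rec f (g : nat -> nat -> nat -> nat) :
  computable f ->
  total_rec 3 (fun v => g (nth 0 v 0) (nth 0 v 1) (nth 0 v 2)) ->
  computable2 (fun a b => nat_rect _ (f a) (fun i r => g i r a) b).
Proof.
move=> fP gP.
apply: (@total_rec_rec 2 (fun v => nth 0 v 1) (fun v => f (nth 0 v 0))
  (fun i r v => g i r (nth 0 v 0))); first exact: total_rec_nth.
- by apply: (total_rec_fun1 fP); apply: total_rec_nth.
apply: total_rec_ext (total_rec_reindex (m := 3) (k := 4) (r := id) _ gP);
  last by move=> i /ltnW.
move=> v.
by rewrite /= nth_drop.
Qed.

Lemma computable_id : computable id.
Proof. by apply/computable_total_rec; apply: total_rec_nth. Qed.

Lemma computable2_add : computable2 addn.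
Proof.
apply: total_rec_ext (computable2_rec (g := fun _ r _ => r.+1) computable_id _) => [v|].
  by elim: (nth 0 v 1) => [|n /= ->]; rewrite ?addn0 ?addnS.
by apply: (total_rec_fun1 computable_succ); apply: total_rec_nth.
Qed.

Lemma computable_const n : computable (fun=> n).
Proof. by apply/computable_total_rec; apply: total_rec_const. Qed.

Lemma computable2_mul : computable2 muln.
Proof.
apply: total_rec_ext (computable2_rec (g := fun _ r a => a + r)
  (computable_const 0) _) => [v|].
  by elim: (nth 0 v 1) => [|n /= ->]; rewrite ?muln0 ?mulnS.
by apply: (total_rec_fun2 computable2_add); apply: total_rec_nth.
Qed.

Lemma computable_pred : computable predn.
Proof.
apply/computable_total_rec.
apply: total_rec_ext (total_rec_rec (N := fun v => nth 0 v 0)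
   (g := fun i _ _ => i) _ (@total_rec_const 1 0) _) => [v||]; try exact: total_rec_nth.
by case: (nth 0 v 0).
Qed.

Lemma computable2_sub : computable2 subn.
Proof.
apply: total_rec_ext (computable2_rec (g := fun _ r a => r.-1) computable_id _) => [v|].
  by elim: (nth 0 v 1) => [|n /= ->]; rewrite ?subn0 ?subnS.
by apply: (total_rec_fun1 computable_pred); apply: total_rec_nth.
Qed.

Lemma computable_eq0 : computable (fun n => n == 0).
Proof.
apply/computable_total_rec.
apply: total_rec_ext (total_rec_fun2 computable2_sub (@total_rec_const 1 1)
  (@total_rec_nth 1 0 isT)) => v.
by case: (nth 0 v 0) => [|[]].
Qed.

Lemma computable2_eq : computable2 (fun a b => a == b).
Proof.
apply: total_rec_ext (total_rec_fun1 computable_eq0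
  (total_rec_fun2 computable2_add computable2_sub
     (total_rec_fun2 computable2_sub (@total_rec_nth 2 1 isT) (@total_rec_nth 2 0 isT)))).
by move=> v /=; rewrite addn_eq0 !subn_eq0 -eqn_leq.
Qed.

Lemma computable_pow2 : computable (expn 2).
Proof.
apply/computable_total_rec.
apply: total_rec_ext (total_rec_rec (N := fun v => nth 0 v 0)
   (g := fun _ r _ => r + r) _ (@total_rec_const 1 1) _) => [v||].
- by elim: (nth 0 v 0) => //= n ->; rewrite expnS mul2n addnn.
- exact: total_rec_nth.
by apply: (total_rec_fun2 computable2_add); apply: total_rec_nth.
Qed.

Lemma total_rec_and k (p q : seq nat -> bool) :
  total_rec k p -> total_rec k q -> total_rec k (fun v => p v && q v).
Proof.
move=> pP qP; apply: total_rec_ext (total_rec_fun2 computable2_mul pP qP) => v.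
by rewrite mulnb.
Qed.

Lemma total_rec_not k (p : seq nat -> bool) :
  total_rec k p -> total_rec k (fun v => ~~ p v).
Proof.
move=> pP; apply: total_rec_ext (total_rec_fun1 computable_eq0 pP) => v.
by case: (p v).
Qed.

Lemma total_rec_or k (p q : seq nat -> bool) :
  total_rec k p -> total_rec k q -> total_rec k (fun v => p v || q v).
Proof.
move=> /total_rec_not pP /total_rec_not qP.
apply: total_rec_ext (total_rec_not (total_rec_and pP qP)) => v.
by rewrite negb_and !negbK.
Qed.

Lemma total_rec_eq k f g :
  total_rec k f -> total_rec k g -> total_rec k (fun v => f v == g v).
Proof. exact: (@total_rec_fun2 (fun a b => a == b) k f g computable2_eq). Qed.

(** The truth values of the conjuncts are multiplied along a primitive recursion. *)
Lemma total_rec_all k N (p : nat -> seq nat -> bool) :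
  total_rec k N -> total_rec k.+1 (fun v => p (nth 0 v 0) (drop 1 v)) ->
  total_rec k (fun v => all (p^~ v) (iota 0 (N v))).
Proof.
move=> NP pP.
apply: total_rec_ext (total_rec_rec (g := fun i r v => r * p i v) NP
  (@total_rec_const k 1) _) => [v|].
  elim: (N v) => // n IHn.
  have -> : iota 0 n.+1 = rcons (iota 0 n) n by rewrite -cats1 -addn1 iotaD.
  by rewrite all_rcons andbC -mulnb -IHn.
apply: (total_rec_fun2 computable2_mul); first exact: total_rec_nth.
(* The step function receives the counter, the accumulator and [v]; the reindexing skips the
   accumulator, at position 1. *)
have ltk i : i < k.+1 -> (if i is j.+1 then j.+2 else 0) < k.+2 by case: i.
apply: total_rec_ext (total_rec_reindex ltk pP) => v.
rewrite nth_mkseq //; congr (nat_of_bool (p _ _)).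
apply: (@eq_from_nth _ 0); rewrite !size_drop size_mkseq ?size_tuple ?subn2 ?subn1 //.
by move=> i lti; rewrite !nth_drop nth_mkseq.
Qed.

Lemma total_rec_has k N (p : nat -> seq nat -> bool) :
  total_rec k N -> total_rec k.+1 (fun v => p (nth 0 v 0) (drop 1 v)) ->
  total_rec k (fun v => has (p^~ v) (iota 0 (N v))).
Proof.
move=> NP /total_rec_not pP.
apply: total_rec_ext (total_rec_not
  (total_rec_all (p := fun i v => ~~ p i v) NP pP)) => v.
by rewrite -has_predC; congr nat_of_bool; apply: eq_has => i /=; rewrite negbK.
Qed.

(** * Unbounded search *)

Lemma total_rec_mu k (f g : seq nat -> nat) : total_rec k.+1 f ->
  (forall v : k.-tuple nat, f (g v :: v) = 0 /\ forall i, i < g v -> f (i :: v) <> 0) ->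
  total_rec k g.
Proof.
move=> [p pP] gP; exists (RMu p) => v /=; have [fg0 fi] := gP v.
split=> [|i /fi]; first by have := pP [tuple of g v :: v]; rewrite /= fg0.
by have := pP [tuple of i :: v] => /=; case: (f _) => // z ? _; exists z.
Qed.

Lemma computes_fun n (p : recfun n) v y y' :
  computes p v y -> computes p v y' -> y = y'.
Proof.
elim: p v y y' => {n} [n||n i|m n f IHf g IHg|n f IHf g IHg|n f IHf] v y y' /=.
- by move=> -> ->.
- by move=> -> ->.
- by move=> -> ->.
- move=> [w [gw fw]] [w' [gw' fw']]; apply: IHf fw _; suff -> : w = w' by [].
  by apply: eq_from_tnth => i; apply: IHg (gw i) (gw' i).
- move=> [h [h0 hS ->]] [h' [h'0 h'S ->]].
  have: thead v <= thead v by [].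
  elim: {1 3 4}(thead v) => [|k IHk] lek; first exact: IHf h0 h'0.
  by apply: IHg (hS _ lek) _; rewrite (IHk (ltnW lek)); apply: h'S.
- move=> [fy lty] [fy' lty']; case: (ltngtP y y') => // [/lty'|/lty] [z fz].
    by have := IHf _ _ _ fy fz.
  by have := IHf _ _ _ fy' fz.
Qed.

(** As [f] is total, the search for its zero never gets stuck, so it halts exactly when a zero
    exists. *)
Lemma semi_computable_exists f :
  computable2 f -> semi_computable (fun n => exists z, f z n = 0).
Proof.
move=> [p pP]; exists (RMu p) => n; have {}pP z := pP [tuple z; n].
split=> [[z0 fz0]|[z [pz _]]].
  have ex_z : exists z, f z n == 0 by exists z0; apply/eqP.
  case: (ex_minnP ex_z) => z /eqP fz zmin; exists z; split.
    by have := pP z; rewrite /= fz; congr computes; apply: val_inj.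
  move=> i lt_iz; exists (f i n).-1; rewrite prednK; last first.
    by rewrite lt0n; apply: contraTN lt_iz => /zmin; rewrite -leqNgt.
  by have := pP i; congr computes; apply: val_inj.
exists z; by rewrite -(computes_fun pz (y' := f z n)) //; have := pP z;
   congr computes; apply: val_inj.
Qed.

(** * Numbers as binary trees *)

(** The cons step of [CodeSeq.code]: [0] is the empty list, and every positive number is a pair in
    exactly one way. So one number reads both as a list and as a binary tree. *)
Definition cpair a b := 2 ^ a * b.*2.+1.
Definition chead n := head 0 (CodeSeq.decode n).
Definition ctail n := CodeSeq.code (behead (CodeSeq.decode n)).

Lemma cpairE a b : cpair a b = CodeSeq.code (a :: CodeSeq.decode b).
Proof. by rewrite /= CodeSeq.decodeK. Qed.

Lemma chead_pair a b : chead (cpair a b) = a.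
Proof. by rewrite /chead cpairE CodeSeq.codeK. Qed.

Lemma ctail_pair a b : ctail (cpair a b) = b.
Proof. by rewrite /ctail cpairE CodeSeq.codeK /= CodeSeq.decodeK. Qed.

Lemma cpair_gt0 a b : 0 < cpair a b.
Proof. by rewrite muln_gt0 expn_gt0. Qed.

Lemma cpair_headtail n : 0 < n -> cpair (chead n) (ctail n) = n.
Proof.
rewrite cpairE /chead /ctail CodeSeq.codeK => n0.
rewrite -[in RHS](CodeSeq.decodeK n); case E: (CodeSeq.decode n) => [|a s] //.
by move: n0; rewrite -(CodeSeq.decodeK n) E.
Qed.

Lemma ltn_cpairl a b : a < cpair a b.
Proof. by apply: leq_trans (ltn_expl a (ltnSn 1)) _; rewrite leq_pmulr. Qed.

Lemma ltn_cpairr a b : b < cpair a b.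
Proof.
by apply: (@leq_trans b.*2.+1); rewrite ?leq_pmull ?expn_gt0 // ltnS -addnn leq_addr.
Qed.

Lemma cpair_inj a b a' b' : cpair a b = cpair a' b' -> a = a' /\ b = b'.
Proof.
move=> E; split; first by rewrite -(chead_pair a b) E chead_pair.
by rewrite -(ctail_pair a b) E ctail_pair.
Qed.

Lemma computable2_cpair : computable2 cpair.
Proof.
apply: (total_rec_fun2 computable2_mul).
  by apply: (total_rec_fun1 computable_pow2); apply: total_rec_nth.
apply: (total_rec_fun1 computable_succ).
apply: total_rec_ext (total_rec_fun2 computable2_add
  (@total_rec_nth 2 1 isT) (@total_rec_nth 2 1 isT)) => v.
by rewrite addnn.
Qed.

(** The components of a pair are smaller than the pair, which bounds the inner search. At [0], which
    is no pair, the first disjunct stops the outer search at the default value [0]. *)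
Lemma computable_chead : computable chead.
Proof.
apply/computable_total_rec.
apply: (@total_rec_mu 1 (fun v => ~~ ((nth 0 v 1 == 0) ||
  has (fun b => cpair (nth 0 v 0) b == nth 0 v 1) (iota 0 (nth 0 v 1))))).
  apply: total_rec_not; apply: total_rec_or.
    by apply: total_rec_eq; [apply: total_rec_nth | apply: total_rec_const].
  apply: (total_rec_has (p := fun b v => cpair (nth 0 v 0) b == nth 0 v 1)).
    exact: total_rec_nth.
  apply: total_rec_eq; last exact: total_rec_nth_drop.
  apply: (total_rec_fun2 computable2_cpair); last exact: total_rec_nth.
  exact: total_rec_nth_drop.
move=> v /=; move: (nth 0 v 0) => n; case: (posnP n) => [-> //|n0].
rewrite -(cpair_headtail n0) /= chead_pair; split=> [|a lta]; last first.
  by case: hasP => // -[b _ /eqP /cpair_inj[Ea _]]; rewrite Ea ltnn in lta.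
case: hasP => // -[].
by exists (ctail n); rewrite ?eqxx // mem_iota ltn_cpairr.
Qed.

Lemma computable_ctail : computable ctail.
Proof.
apply/computable_total_rec.
apply: (@total_rec_mu 1 (fun v => ~~ ((nth 0 v 1 == 0) ||
  has (fun a => cpair a (nth 0 v 0) == nth 0 v 1) (iota 0 (nth 0 v 1))))).
  apply: total_rec_not; apply: total_rec_or.
    by apply: total_rec_eq; [apply: total_rec_nth | apply: total_rec_const].
  apply: (total_rec_has (p := fun a v => cpair a (nth 0 v 0) == nth 0 v 1)).
    exact: total_rec_nth.
  apply: total_rec_eq; last exact: total_rec_nth_drop.
  apply: (total_rec_fun2 computable2_cpair); first exact: total_rec_nth.
  exact: total_rec_nth_drop.
move=> v /=; move: (nth 0 v 0) => n; case: (posnP n) => [-> //|n0].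
rewrite -(cpair_headtail n0) /= ctail_pair; split=> [|b ltb]; last first.
  by case: hasP => // -[a _ /eqP /cpair_inj[_ Eb]]; rewrite Eb ltnn in ltb.
case: hasP => // -[].
by exists (chead n); rewrite ?eqxx // mem_iota ltn_cpairl.
Qed.

Definition cnth n i := nth 0 (CodeSeq.decode n) i.

Lemma computable2_cnth : computable2 cnth.
Proof.
apply: total_rec_ext (total_rec_fun1 computable_chead
  (computable2_rec (g := fun _ r _ => ctail r) computable_id _)) => [v|].
  move: (nth 0 v 1) (nth 0 v 0) => i n; rewrite /chead /cnth.
  suff -> : nat_rect _ n (fun _ r => ctail r) i =
      CodeSeq.code (drop i (CodeSeq.decode n)).
    by rewrite CodeSeq.codeK -nth0 nth_drop addn0.
  elim: i => /= [|i ->]; first by rewrite drop0 CodeSeq.decodeK.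
  by rewrite /ctail CodeSeq.codeK -drop1 drop_drop add1n.
by apply: (total_rec_fun1 computable_ctail); apply: total_rec_nth.
Qed.

Inductive tree := L | N of tree & tree.

Fixpoint tnat t := if t is N a b then cpair (tnat a) (tnat b) else 0.

Lemma tnat_inj : injective tnat.
Proof.
elim=> [|a IHa b IHb] [|a' b'] //= => [E|E|/cpair_inj[/IHa -> /IHb ->] //].
  by have := cpair_gt0 (tnat a') (tnat b'); rewrite -E.
by have := cpair_gt0 (tnat a) (tnat b); rewrite E.
Qed.

(** [k] is fuel; [n] itself is enough, since the components of a pair are smaller than it. *)
Fixpoint ntree_rec k n :=
  if k is k'.+1 then
    if n == 0 then L else N (ntree_rec k' (chead n)) (ntree_rec k' (ctail n))
  else L.
Definition ntree n := ntree_rec n n.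

Lemma ntreeK : cancel ntree tnat.
Proof.
move=> n; rewrite /ntree; suff: forall k, n <= k -> tnat (ntree_rec k n) = n by apply.
move=> k; elim: k n => [|k IHk] n; first by case: n.
rewrite /=; case: (posnP n) => [-> //|n0] len /=.
rewrite !IHk ?cpair_headtail // -ltnS; apply: leq_trans len;
  by rewrite -[ltnRHS]cpair_headtail ?ltn_cpairl ?ltn_cpairr.
Qed.

Lemma tnatK : cancel tnat ntree.
Proof. exact: inj_can_sym ntreeK tnat_inj. Qed.

Definition tlist := foldr N L.

Lemma tnat_tlist s : tnat (tlist s) = CodeSeq.code (map tnat s).
Proof. by elim: s => //= x s ->. Qed.

(** * Horn rules over trees, and the search for derivations *)

Inductive pat := PVar of nat | PLeaf | PNode of pat & pat.

Fixpoint inst (w : seq tree) p :=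
  match p with
  | PVar i => nth L w i
  | PLeaf => L
  | PNode p q => N (inst w p) (inst w q)
  end.

Fixpoint ninst (w : nat) p :=
  match p with
  | PVar i => cnth w i
  | PLeaf => 0
  | PNode p q => cpair (ninst w p) (ninst w q)
  end.

Lemma ninstE w p : ninst w p = tnat (inst (map ntree (CodeSeq.decode w)) p).
Proof.
elim: p => //= [i|p -> q -> //]; rewrite /cnth; set s := CodeSeq.decode w.
case: (ltnP i (size s)) => lti; first by rewrite (nth_map 0) // ntreeK.
by rewrite !nth_default // size_map.
Qed.

Lemma computable_ninst p : computable (ninst^~ p).
Proof.
apply/computable_total_rec.
elim: p => [i||p IHp q IHq] /=; last exact: (total_rec_fun2 computable2_cpair).
  apply: (total_rec_fun2 computable2_cnth); first exact: total_rec_nth.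
  exact: total_rec_const.
exact: total_rec_const.
Qed.

Fixpoint all_of T (P : T -> Prop) s := if s is x :: s' then P x /\ all_of P s' else True.

Lemma all_ofP T (P : T -> Prop) s : all_of P s <-> forall x, List.In x s -> P x.
Proof.
elim: s => //= x s IHs; split=> [[Px /IHs Ps] y [<- //|]|Ps]; first exact: Ps.
by split; [apply: Ps; left | apply/IHs => y sy; apply: Ps; right].
Qed.

(** A guard [(f, p, q)] asks [f] to send the number of [p] to the number of [q]. Variables absent
    from the conclusion are existential, as a rule applies under any instance. *)
Record rule := Rule {
  concl : pat;
  prems : seq pat;
  guards : seq ((nat -> nat) * pat * pat)
}.

Definition guard_ok (w : seq tree) (g : (nat -> nat) * pat * pat) :=
  g.1.1 (tnat (inst w g.1.2)) = tnat (inst w g.2).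

Section Derivability.

Variable prog : seq rule.

Inductive derivable : tree -> Prop :=
| Derivable r w of List.In r prog & all_of (guard_ok w) (guards r)
  & (forall p, List.In p (prems r) -> derivable (inst w p)) :
  derivable (inst w (concl r)).

(* A derivation is a number list whose entries [cpair x w] give each a derived
   tree [x] and the instance [w] of a rule that yields [x] from earlier entries. *)
Definition derived_before (c i x : nat) :=
  has (fun j => chead (cnth c j) == x) (iota 0 i).

Definition step_ok (c i : nat) (r : rule) :=
  let w := ctail (cnth c i) in
  [&& ninst w (concl r) == chead (cnth c i),
      all (fun g => g.1.1 (ninst w g.1.2) == ninst w g.2) (guards r)
    & all (fun p => derived_before c i (ninst w p)) (prems r)].

(** [z] stores the length beside the list of entries, so no length has to be computed. *)
Definition check_deriv (z n : nat) :=
  all (fun i => has (step_ok (ctail z) i) prog) (iota 0 (chead z)) &&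
  derived_before (ctail z) (chead z) n.

Hypothesis prog_ok :
  all_of (fun r => all_of (fun g => computable g.1.1) (guards r)) prog.

Lemma derived_before_computable :
  total_rec 3 (fun v => derived_before (nth 0 v 0) (nth 0 v 1) (nth 0 v 2)).
Proof.
apply: (total_rec_has (p := fun j v => chead (cnth (nth 0 v 0) j) == nth 0 v 2)).
  exact: total_rec_nth.
apply: total_rec_eq; last exact: total_rec_nth_drop.
apply: (total_rec_fun1 computable_chead); apply: (total_rec_fun2 computable2_cnth).
  exact: total_rec_nth_drop.
exact: total_rec_nth.
Qed.

(** The program is a fixed finite list, so its rules form a finite disjunction and no interpreter of
    coded rules is needed. *)
Lemma step_ok_computable :
  computable2 (fun c i => has (step_ok c i) prog).
Proof.
have enP : computable2 cnth := computable2_cnth.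
have instP p : computable2 (fun c i => ninst (ctail (cnth c i)) p).
  apply: (total_rec_fun1 (computable_ninst p)).
  exact: (total_rec_fun1 computable_ctail).
elim: prog prog_ok => [|r rs IHrs] /=; first by move=> _; apply: total_rec_const.
move=> [rP /IHrs{}IHrs]; apply: total_rec_or IHrs.
apply: total_rec_and; first last.
  apply: total_rec_and.
    elim: (guards r) rP => [|g gs IHgs] /=; first by move=> _; apply: total_rec_const.
    move=> [gP /IHgs{}IHgs]; apply: total_rec_and IHgs.
    by apply: total_rec_eq; [apply: (total_rec_fun1 gP) | ]; apply: instP.
  elim: (prems r) => [|p ps IHps] /=; first exact: total_rec_const.
  apply: total_rec_and IHps.
  by apply: (@total_rec_fun3 (fun c i x => derived_before c i x) _ _ _ _
      derived_before_computable);
    [apply: total_rec_nth | apply: total_rec_nth | apply: instP].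
apply: total_rec_eq; first exact: instP.
exact: (total_rec_fun1 computable_chead).
Qed.

Lemma check_deriv_computable : computable2 check_deriv.
Proof.
have hd k f : total_rec k f -> total_rec k (fun v => chead (f v)).
  exact: total_rec_fun1 computable_chead.
have tl k f : total_rec k f -> total_rec k (fun v => ctail (f v)).
  exact: total_rec_fun1 computable_ctail.
apply: total_rec_and.
  apply: (total_rec_all (p := fun i v => has (step_ok (ctail (nth 0 v 0)) i) prog)).
    exact/hd/total_rec_nth.
  apply: (@total_rec_fun2 (fun c i => has (step_ok c i) prog) _ _ _ step_ok_computable).
    exact/tl/total_rec_nth_drop.
  exact: total_rec_nth.
apply: (@total_rec_fun3 (fun c i x => derived_before c i x) _ _ _ _
  derived_before_computable).
- exact/tl/total_rec_nth.
- exact/hd/total_rec_nth.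
- exact: total_rec_nth.
Qed.

Lemma check_deriv_sound z n : check_deriv z n -> derivable (ntree n).
Proof.
move=> /andP[/allP ok]; move: (ctail z) (chead z) ok => c m ok.
suff der i : i < m -> derivable (ntree (chead (cnth c i))).
  by case/hasP=> j; rewrite mem_iota => /der ? /eqP <-.
elim/ltn_ind: i => i IHi lt_im.
have := ok i; rewrite mem_iota => /(_ lt_im).
suff main rs : (forall r, List.In r rs -> List.In r prog) ->
    has (step_ok c i) rs -> derivable (ntree (chead (cnth c i))) by apply: main.
elim: rs => //= r rs IHrs sub /orP[/and3P[/eqP <- gs ps]|]; last first.
  by apply: IHrs => r' r'P; apply: sub; right.
rewrite ninstE tnatK; apply: Derivable; first by apply: sub; left.
  elim: (guards r) gs => //= g gs IHgs /andP[/eqP gP /IHgs]; split=> //.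
  by move: gP; rewrite !ninstE.
elim: (prems r) ps => //= p ps IHps /andP[pP /IHps {}IHps] q [<-|/IHps //].
case/hasP: pP => j; rewrite mem_iota => /= lt_ji /eqP.
rewrite ninstE => E; rewrite -[inst _ _]tnatK -E.
exact: IHi (ltn_trans lt_ji lt_im).
Qed.

Definition derivation (s : seq nat) :=
  let c := CodeSeq.code s in
  all (fun i => has (step_ok c i) prog) (iota 0 (size s)).

(** An entry cites its premises by content and not by position, so it stays justified when moved
    behind further entries. *)
Lemma step_ok_mono c i c' i' :
  cnth c i = cnth c' i' ->
  (forall x, derived_before c i x -> derived_before c' i' x) ->
  has (step_ok c i) prog -> has (step_ok c' i') prog.
Proof.
move=> Ec sub; apply: sub_has => r /and3P[rP gP pP]; rewrite /step_ok -Ec rP gP /=.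
by apply: sub_all pP => p; apply: sub.
Qed.

Lemma derivation_cat s s' : derivation s -> derivation s' -> derivation (s ++ s').
Proof.
move=> /allP sP /allP s'P; apply/allP => i; rewrite mem_iota size_cat /= add0n => lti.
have nthE j : cnth (CodeSeq.code (s ++ s')) j =
    if j < size s then cnth (CodeSeq.code s) j else cnth (CodeSeq.code s') (j - size s).
  by rewrite /cnth !CodeSeq.codeK nth_cat.
case: (ltnP i (size s)) => [lt_is|le_si].
  have {}sP := sP i; rewrite mem_iota in sP; apply: step_ok_mono (sP lt_is).
    by rewrite nthE lt_is.
  move=> x /hasP[j]; rewrite mem_iota /= add0n => lt_ji jP; apply/hasP; exists j.
    by rewrite mem_iota.
  by rewrite nthE (ltn_trans lt_ji).
have {}s'P := s'P (i - size s); rewrite mem_iota /= add0n in s'P.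
apply: step_ok_mono (s'P _); first by rewrite nthE ltnNge le_si.
  move=> x /hasP[j]; rewrite mem_iota /= add0n => lt_ji jP; apply/hasP.
  exists (size s + j); first by rewrite mem_iota /= add0n -ltn_subRL.
  by rewrite nthE ltnNge leq_addr /= addKn.
by rewrite ltn_subLR.
Qed.

Lemma derivable_derivation t :
  derivable t -> exists2 s, derivation s & tnat t \in map chead s.
Proof.
elim=> {t} r w rP gP _ IH.
have [s sP ps] : exists2 s, derivation s &
    all (fun p => tnat (inst w p) \in map chead s) (prems r).
  elim: (prems r) IH => [|p ps IHps] IH; first by exists [::].
  have [s sP pP] := IH p (or_introl erefl).
  have [s' s'P psP] := IHps (fun q qps => IH q (or_intror qps)).
  exists (s ++ s'); first exact: derivation_cat.
  rewrite /= map_cat mem_cat pP /=; apply: sub_all psP => q.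
  by rewrite mem_cat => ->; rewrite orbT.
(* The new last entry pairs the conclusion with the code of the instance; the premises are already
   derived in [s]. *)
pose en := cpair (tnat (inst w (concl r))) (CodeSeq.code (map tnat w)).
exists (rcons s en); last first.
  by rewrite map_rcons mem_rcons chead_pair mem_head.
have nthE j : j < size s ->
    cnth (CodeSeq.code (rcons s en)) j = cnth (CodeSeq.code s) j.
  by rewrite /cnth !CodeSeq.codeK nth_rcons => ->.
apply/allP => i; rewrite mem_iota size_rcons /= add0n ltnS leq_eqVlt.
case/predU1P => [->|lti]; last first.
  have := allP sP i; rewrite mem_iota /= add0n => /(_ lti).
  apply: step_ok_mono; first by rewrite nthE.
  move=> x /hasP[j ltj jP]; apply/hasP; exists j => //.
  by rewrite nthE //; move: ltj; rewrite mem_iota => /= /ltn_trans; apply.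
have wE p : ninst (CodeSeq.code (map tnat w)) p = tnat (inst w p).
  by rewrite ninstE CodeSeq.codeK (mapK tnatK).
have rok : step_ok (CodeSeq.code (rcons s en)) (size s) r.
  have enE : cnth (CodeSeq.code (rcons s en)) (size s) = en.
    by rewrite /cnth CodeSeq.codeK nth_rcons ltnn eqxx.
  rewrite /step_ok enE chead_pair ctail_pair wE eqxx /=; apply/andP; split.
    elim: (guards r) gP => //= g gs IHgs [gP /IHgs ->].
    by rewrite andbT !wE; apply/eqP.
  apply: sub_all ps => p; rewrite wE => /mapP[en' /(nthP 0)[j ltj <-] ->].
  by apply/hasP; exists j; rewrite ?mem_iota // nthE // /cnth CodeSeq.codeK.
elim: prog rP => //= r' rs IHrs [->|/IHrs ->]; last by rewrite orbT.
by rewrite rok.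
Qed.

Lemma semi_computable_derivable (f : nat -> nat) :
  computable f -> semi_computable (fun n => derivable (ntree (f n))).
Proof.
move=> fP.
have: computable2 (fun z n => ~~ check_deriv z (f n)).
  apply: total_rec_not.
  apply: (@total_rec_fun2 (fun z n => check_deriv z n) _ _ _ check_deriv_computable).
    exact: total_rec_nth.
  by apply: (total_rec_fun1 fP); apply: total_rec_nth.
case/semi_computable_exists => p pP; exists p => n; rewrite -pP.
split=> [/derivable_derivation[s sP ns]|[z zP]]; last first.
  by apply: (@check_deriv_sound z); case: check_deriv zP.
exists (cpair (size s) (CodeSeq.code s)).
rewrite /check_deriv chead_pair ctail_pair (_ : all _ _) //=.
rewrite (_ : derived_before _ _ _) //; move: ns; rewrite ntreeK.
case/(nthP 0) => j; rewrite size_map => ltj <-; apply/hasP; exists j.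
  by rewrite mem_iota.
by rewrite (nth_map 0) // /cnth CodeSeq.codeK.
Qed.

End Derivability.

(** * Contradictory sets of literals, as a Horn program *)

(** Trees and patterns share their constructors, so that instantiating a pattern shape yields the
    tree shape by computation. *)
Class nodes T := Nodes { leaf : T; node : T -> T -> T }.
#[local] Instance tree_nodes : nodes tree := Nodes L N.
#[local] Instance pat_nodes : nodes pat := Nodes PLeaf PNode.

Section Shapes.

Context {T : Type} {nodesT : nodes T}.
Implicit Types t l e p q x a b : T.

Definition lst : seq T -> T := foldr node leaf.
(** [mark k] is the tree of [2 ^ k - 1]. The tags 0 to 5 of formulas include [mark 0], [mark 1] and
    [mark 2], that is 0, 1 and 3; this is why the tags of literals start at [mark 3]. *)
Fixpoint mark k : T := if k is k'.+1 then node leaf (mark k') else leaf.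

(** The trees of the numbers 1 to 5, the constructor tags of the Goedel numbering. *)
Definition num1 : T := node leaf leaf.
Definition num2 : T := node num1 leaf.
Definition num3 : T := node leaf num1.
Definition num4 : T := node num2 leaf.
Definition num5 : T := node leaf num2.

Definition cVar x := lst [:: leaf; x].
Definition cConst x := lst [:: num1; x].
Definition cApp x l := node num2 (node x l).
Definition cTr := lst [:: leaf].
Definition cFa := lst [:: num1].
Definition cEqp t p := lst [:: num2; t; p].
Definition cNeg p := lst [:: num3; p].
Definition cOrl p q := lst [:: num4; p; q].
Definition cAllp x p := lst [:: num5; x; p].

Definition bind x a e := node (node x a) e.
(* The name of an undefined term denotes an arbitrary element; [atDef] tells
   whether the term is defined. *)
Definition nmTerm t e := node (mark 0) (node t e).
(* A witness that the formula [p] with the bound variable [x] is not satisfied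
   ([k = 1]), is denied ([k = 2]), or is neither satisfied nor denied ([k = 3]). *)
Definition nmWit k x p e := node (mark k) (node x (node p e)).

Definition atSat p e := node (mark 0) (node p e).
Definition atDeny p e := node (mark 1) (node p e).
Definition atDef t e := node (mark 2) (node t e).
Definition atEq a b := node (mark 3) (node a b).

(* A literal is [pos a], [neg a], or the code of a formula, which stands for its
   satisfaction under all valuations.  The codes of formulas begin with a number
   up to 5, hence with a tree other than [mark 3] and [mark 4]. *)
Definition pos a := node (mark 3) a.
Definition neg a := node (mark 4) a.

Definition isTerm t := node (mark 0) t.
Definition isTerms x l := node (mark 1) (node x l).
Definition isForm p := node (mark 2) p.
Definition isForms l := node (mark 3) l.
Definition isMem x l := node (mark 4) (node x l).
Definition isIncl p l := node (mark 5) (node p l).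
Definition isRefuted l := node (mark 6) l.
Definition isConflict l := node (mark 7) l.
(* [p] lists the literals that assert that the terms of [l] are defined in [e]. *)
Definition isDefs l e p := node (mark 8) (node l (node e p)).
(* [p] lists the literals that assert that the terms of [l] in [e] are equal to
   those of [q] in [a], and that the latter are defined. *)
Definition isCong l e q a p := node (mark 9) (node l (node e (node q (node a p)))).
Definition isConseq l := node (mark 10) l.

End Shapes.

Fixpoint rank t := if t is N _ t' then (rank t').+1 else 0.

Definition v0 := PVar 0.
Definition v1 := PVar 1.
Definition v2 := PVar 2.
Definition v3 := PVar 3.
Definition v4 := PVar 4.
Definition v5 := PVar 5.
Definition v6 := PVar 6.

Definition neq_guard n : nat := chead n != ctail n.
Definition conflict C ps gs := Rule (isConflict (lst C)) ps gs.

(** * The rules for a given signature *)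

Section Program.

Variable S : signature.

Definition const_guard n : nat := pickle_inv n : option (const_sym S).
Definition arity_guard n := if pickle_inv n is Some f then @arity S f else 0.
Definition total_guard n : nat :=
  if pickle_inv n is Some f then @is_total S f : nat else 0.

Definition syntax_rules : seq rule :=
  [:: Rule (isTerm (cVar v0)) [::] [::];
      Rule (isTerm (cConst v0)) [::] [:: (const_guard, v0, num1)];
      Rule (isTerm (cApp v0 v1)) [:: isTerms (node v2 v3) v1]
        [:: (arity_guard, v0, node v2 v3)];
      Rule (isTerms leaf leaf) [::] [::];
      Rule (isTerms v0 (node v1 v2)) [:: isTerm v1; isTerms v3 v2]
        [:: (succn, v3, v0)];
      Rule (isForm cTr) [::] [::];
      Rule (isForm cFa) [::] [::];
      Rule (isForm (cEqp v0 v1)) [:: isTerm v0; isTerm v1] [::];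
      Rule (isForm (cNeg v0)) [:: isForm v0] [::];
      Rule (isForm (cOrl v0 v1)) [:: isForm v0; isForm v1] [::];
      Rule (isForm (cAllp v0 v1)) [:: isForm v1] [::];
      Rule (isForms leaf) [::] [::];
      Rule (isForms (node v0 v1)) [:: isForm v0; isForms v1] [::] ].

(** Containing a conflict and splitting on an arbitrary atom are the leaves and the branchings of a
    semantic tree. Inclusion disregards order and repetition of literals. *)
Definition refutation_rules : seq rule :=
  [:: Rule (isMem v0 (node v0 v1)) [::] [::];
      Rule (isMem v0 (node v1 v2)) [:: isMem v0 v2] [::];
      Rule (isIncl leaf v0) [::] [::];
      Rule (isIncl (node v0 v1) v2) [:: isMem v0 v2; isIncl v1 v2] [::];
      Rule (isRefuted v0) [:: isConflict v1; isIncl v1 v0] [::];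
      Rule (isRefuted v0)
        [:: isRefuted (node (pos v1) v0); isRefuted (node (neg v1) v0)] [::];
      Rule (isConseq (node v0 v1))
        [:: isForm v0; isForms v1; isRefuted (node (neg (atSat v0 leaf)) v1)] [::] ].

(* [v0], [v1] : subformulas or subterms (for a quantifier, [v0] is its variable);
   [v2] : environment; [v3] : name. *)
Definition formula_rules : seq rule :=
  let eq := cEqp v0 v1 in let tms := [:: isTerm v0; isTerm v1] in
  let eqnm := atEq (nmTerm v0 v2) (nmTerm v1 v2) in
  let ng := cNeg v0 in let fm := [:: isForm v0] in
  let or := cOrl v0 v1 in let fms := [:: isForm v0; isForm v1] in
  let al := cAllp v0 v1 in let body := [:: isForm v1] in
  let ext a := bind v0 a v2 in let wit k := nmWit k v0 v1 v2 in
  [:: conflict [:: neg (atSat cTr v2)] [::] [::];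
      conflict [:: pos (atDeny cTr v2)] [::] [::];
      conflict [:: pos (atSat cFa v2)] [::] [::];
      conflict [:: neg (atDeny cFa v2)] [::] [::];
      conflict [:: pos (atSat eq v2); neg (atDef v0 v2)] tms [::];
      conflict [:: pos (atSat eq v2); neg (atDef v1 v2)] tms [::];
      conflict [:: pos (atSat eq v2); neg eqnm] tms [::];
      conflict [:: pos (atDef v0 v2); pos (atDef v1 v2); pos eqnm;
                   neg (atSat eq v2)] tms [::];
      conflict [:: pos (atDeny eq v2); neg (atDef v0 v2)] tms [::];
      conflict [:: pos (atDeny eq v2); neg (atDef v1 v2)] tms [::];
      conflict [:: pos (atDeny eq v2); pos eqnm] tms [::];
      conflict [:: pos (atDef v0 v2); pos (atDef v1 v2); neg eqnm;
                   neg (atDeny eq v2)] tms [::];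
      conflict [:: pos (atSat ng v2); neg (atDeny v0 v2)] fm [::];
      conflict [:: pos (atDeny v0 v2); neg (atSat ng v2)] fm [::];
      conflict [:: pos (atDeny ng v2); neg (atSat v0 v2)] fm [::];
      conflict [:: pos (atSat v0 v2); neg (atDeny ng v2)] fm [::];
      conflict [:: pos (atSat v0 v2); neg (atSat or v2)] fms [::];
      conflict [:: pos (atDeny v0 v2); pos (atSat v1 v2); neg (atSat or v2)]
        fms [::];
      conflict [:: pos (atSat or v2); neg (atSat v0 v2); neg (atDeny v0 v2)]
        fms [::];
      conflict [:: pos (atSat or v2); neg (atSat v0 v2); neg (atSat v1 v2)]
        fms [::];
      conflict [:: pos (atDeny or v2); neg (atDeny v0 v2)] fms [::];
      conflict [:: pos (atDeny or v2); neg (atDeny v1 v2)] fms [::];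
      conflict [:: pos (atDeny v0 v2); pos (atDeny v1 v2); neg (atDeny or v2)]
        fms [::];
      conflict [:: pos (atSat al v2); neg (atSat v1 (ext v3))] body [::];
      conflict [:: pos (atSat v1 (ext (wit 1))); neg (atSat al v2)] body [::];
      conflict [:: pos (atDeny al v2); neg (atDeny v1 (ext (wit 2)))] body [::];
      conflict [:: pos (atDeny al v2); neg (atSat v1 (ext v3));
                   neg (atDeny v1 (ext v3))] body [::];
      (* If the body is denied somewhere and [al] is not denied, the body is undecided at some
         value. The third witness is such a value, and the two clauses exclude that the body is
         satisfied or denied there. *)
      conflict [:: pos (atDeny v1 (ext v3)); pos (atSat v1 (ext (wit 3)));
                   neg (atDeny al v2)] body [::];
      conflict [:: pos (atDeny v1 (ext v3)); pos (atDeny v1 (ext (wit 3)));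
                   neg (atDeny al v2)] body [::];
      conflict [:: v0; neg (atSat v0 v2)] fm [::] ].

(** Arities vary, so the clauses on applications have no fixed length; [isDefs] and [isCong] build
    their tails. A congruence tail also asserts that the second arguments are defined, because the
    name of an undefined term may denote the value of a defined one. *)
Definition term_rules : seq rule :=
  [:: conflict [:: pos v0; neg v0] [::] [::];
      conflict [:: neg (atEq v0 v0)] [::] [::];
      conflict [:: pos (atEq v0 v1); pos (atEq v0 v2); neg (atEq v1 v2)] [::] [::];
      conflict [:: neg (atDef (cVar v0) v1)] [::] [::];
      conflict [:: neg (atEq (nmTerm (cVar v0) (bind v0 v1 v2)) v1)] [::] [::];
      conflict [:: neg (atEq (nmTerm (cVar v0) (bind v3 v1 v2))
                             (nmTerm (cVar v0) v2))]
        [::] [:: (neq_guard, node v0 v3, num1)];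
      conflict [:: neg (atDef (cConst v0) v1)] [::] [:: (const_guard, v0, num1)];
      conflict [:: neg (atEq (nmTerm (cConst v0) v1) (nmTerm (cConst v0) v2))]
        [::] [:: (const_guard, v0, num1)];
      conflict [:: pos (atDef (cApp v0 v1) v2); neg (atDef v3 v2)]
        [:: isTerm (cApp v0 v1); isMem v3 v1] [::];
      Rule (isDefs leaf v0 leaf) [::] [::];
      Rule (isDefs (node v0 v1) v2 (node (pos (atDef v0 v2)) v3))
        [:: isDefs v1 v2 v3] [::];
      Rule (isConflict (node (neg (atDef (cApp v0 v1) v2)) v3))
        [:: isTerm (cApp v0 v1); isDefs v1 v2 v3] [:: (total_guard, v0, num1)];
      Rule (isCong leaf v0 leaf v1 leaf) [::] [::];
      Rule (isCong (node v0 v1) v2 (node v3 v4) v5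
              (node (pos (atDef v3 v5))
                 (node (pos (atEq (nmTerm v0 v2) (nmTerm v3 v5))) v6)))
        [:: isCong v1 v2 v4 v5 v6] [::];
      Rule (isConflict (node (neg (atDef (cApp v0 v3) v4))
              (node (pos (atDef (cApp v0 v1) v2)) v5)))
        [:: isTerm (cApp v0 v1); isTerm (cApp v0 v3); isCong v1 v2 v3 v4 v5] [::];
      Rule (isConflict (node (neg (atEq (nmTerm (cApp v0 v1) v2)
                                        (nmTerm (cApp v0 v3) v4)))
              (node (pos (atDef (cApp v0 v1) v2)) v5)))
        [:: isTerm (cApp v0 v1); isTerm (cApp v0 v3); isCong v1 v2 v3 v4 v5] [::] ].

Definition program := syntax_rules ++ refutation_rules ++ formula_rules ++ term_rules.

Fixpoint tterm (t : term S) : tree :=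
  match t with
  | Var x => cVar (ntree x)
  | Const c => cConst (ntree (pickle c))
  | App f ts =>
      cApp (ntree (pickle f)) (lst [seq tterm (ts i) | i <- enum 'I_(arity f)])
  end.

Fixpoint tform (phi : formula S) : tree :=
  match phi with
  | Tr => cTr
  | Fa => cFa
  | Eqp t r => cEqp (tterm t) (tterm r)
  | Neg phi => cNeg (tform phi)
  | Orl phi psi => cOrl (tform phi) (tform psi)
  | Allp x phi => cAllp (ntree x) (tform phi)
  end.

Lemma tnat_tterm t : tnat (tterm t) = code_term t.
Proof.
elim: t => [x|c|f ts IHts] /=.
- by rewrite ntreeK /cpair.
- by rewrite ntreeK /cpair.
rewrite ntreeK /cpair /=; congr (2 ^ _ * (2 ^ _ * _.*2.+1).*2.+1).
by elim: (enum _) => //= i s ->; rewrite IHts.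
Qed.

Lemma tnat_tform phi : tnat (tform phi) = code_formula phi.
Proof.
by elim: phi => [||t r|phi IH|phi IH psi IH'|x phi IH] //=;
   rewrite ?tnat_tterm ?ntreeK ?IH ?IH'.
Qed.

Lemma ntree_sequent Gamma phi :
  ntree (code_sequent Gamma phi) = node (tform phi) (lst (map tform Gamma)).
Proof.
apply: (canLR tnatK); rewrite /= tnat_tform tnat_tlist -map_comp.
by congr (_ * (CodeSeq.code _).*2.+1); apply: eq_map => psi /=; rewrite tnat_tform.
Qed.

Lemma tterm_inj : injective tterm.
Proof.
elim=> [x|c|f ts IHts] [x'|c'|f' ts'] //=.
- by case=> /(can_inj ntreeK) ->.
- by case=> /(can_inj ntreeK) /(pcan_inj pickleK) ->.
case=> /(can_inj ntreeK) /(pcan_inj pickleK) Ef; case: f' / Ef ts' => ts' E.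
congr App; apply/funext => i; apply: IHts.
have := mem_enum 'I_(arity f) i; move: E; rewrite /= .
elim: (enum _) => //= j s IHs [Ej /IHs{}IHs].
by rewrite inE => /orP[/eqP ->|].
Qed.

(** By injectivity, the meaning of a tree can be given through some formula with that tree, without
    a decoding function. *)
Lemma tform_inj : injective tform.
Proof.
elim=> [||t r|phi IH|phi IH psi IH'|x phi IH] [||t' r'|phi'|phi' psi'|x' phi'] //=.
- by case=> /tterm_inj -> /tterm_inj ->.
- by case=> /IH ->.
- by case=> /IH -> /IH' ->.
by case=> /(can_inj ntreeK) -> /IH ->.
Qed.

End Program.

(** * Soundness *)

Fixpoint tin x l := if l is N y l' then x = y \/ tin x l' else False.

(** On a concrete clause this computes to a chain of implications ending in [False], which suits
    both checking a rule and using it. *)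
Fixpoint refutes (P : tree -> Prop) l :=
  if l is N x l' then P x -> refutes P l' else False.

Lemma refutesP P l : refutes P l <-> ~ (forall x, tin x l -> P x).
Proof.
elim: l => [|x _ l IHl] /=; first by split=> // n; apply: n.
split=> [Pl all|nall Px]; first by apply: (IHl.1 (Pl _)) => *; apply: all; auto.
by apply/IHl => all; apply: nall => y [->|/all].
Qed.

Lemma denotes_fun S (A : algebra S) (s : nat -> A) t a b :
  denotes s t a -> denotes s t b -> a = b.
Proof.
elim: t a b => [x|c|f ts IHts] a b /=; [by move=> <-|by move=> <-|].
move=> [v [vP fa]] [w [wP fb]]; apply: Some_inj; rewrite -fa -fb; congr fun_val.
by apply: eq_from_tnth => i; apply: IHts (vP i) (wP i).
Qed.

Lemma rank_mark k : rank (mark k) = k.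
Proof. by elim: k => //= k ->. Qed.

(** * Names, atoms and literals in a structure *)

Section Interpretation.

Variables (S : signature) (A : algebra S) (s0 : nat -> A).

Definition pick_val (P : A -> Prop) : A :=
  if pselect (exists a, P a) is left exP then sval (cid exP) else s0 0.

Lemma pick_valP P : (exists a, P a) -> P (pick_val P).
Proof. by rewrite /pick_val; case: pselect => // exP _; case: cid. Qed.

Definition witness_prop k (s : nat -> A) phi :=
  match k with
  | 1 => ~ sat s phi
  | 2 => deny s phi
  | _ => ~ sat s phi /\ ~ deny s phi
  end.

(** Names and environments contain each other, hence the mutual recursion. The name of an undefined
    term falls back on [s0 0] through [pick_val], and the empty environment is the base valuation
    [s0]. *)
Fixpoint name_val n : A :=
  match n with
  | N tg (N t e) =>
      match rank tg, e with
      | 0, _ => pick_val (fun a => exists2 T, t = tterm T & denotes (env_val e) T a)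
      | k, N p e' => pick_val (fun a => exists2 phi, p = tform phi
                       & witness_prop k (upd (env_val e') (tnat t) a) phi)
      | _, _ => s0 0
      end
  | _ => s0 0
  end
with env_val e : nat -> A :=
  match e with
  | N (N x a) e' => upd (env_val e') (tnat x) (name_val a)
  | _ => s0
  end.

(** Atoms about trees that code no formula or term are false. Clauses could fail on such trees,
    which the premises [isForm] and [isTerm] exclude. *)
Definition atom_val a :=
  match a with
  | N tg (N p e) =>
      match rank tg with
      | 0 => exists2 phi : formula S, p = tform phi & sat (env_val e) phi
      | 1 => exists2 phi : formula S, p = tform phi & deny (env_val e) phi
      | 2 => exists2 T : term S, p = tterm T & exists x, denotes (env_val e) T x
      | _ => name_val p = name_val e
      end
  | _ => False
  end.

Definition lit_val l :=
  match l with
  | N tg p =>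
      match rank tg with
      | 3 => atom_val p
      | 4 => ~ atom_val p
      | _ => forall phi : formula S, l = tform phi -> forall s : nat -> A, sat s phi
      end
  | L => True
  end.

(** The tags that begin codes of formulas have rank at most 2, so these codes avoid the cases 3 and
    4. *)
Lemma lit_val_form (phi : formula S) :
  lit_val (tform phi) <-> forall s : nat -> A, sat s phi.
Proof.
have: lit_val (tform phi) = forall psi : formula S, tform phi = tform psi ->
  forall s : nat -> A, sat s psi by case: phi.
by move=> ->; split=> [/(_ _ erefl)|phiP psi /tform_inj <-].
Qed.

Lemma atom_val_sat phi e : atom_val (atSat (tform phi) e) = sat (env_val e) phi.
Proof. by apply/propext; split=> [[psi /tform_inj ->]|]; last by exists phi. Qed.

Lemma atom_val_deny phi e : atom_val (atDeny (tform phi) e) = deny (env_val e) phi.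
Proof. by apply/propext; split=> [[psi /tform_inj ->]|]; last by exists phi. Qed.

Lemma atom_val_def t e :
  atom_val (atDef (tterm t) e) = exists x, denotes (env_val e) t x.
Proof. by apply/propext; split=> [[r /tterm_inj ->]|]; last by exists t. Qed.

Lemma name_val_term t e a : denotes (env_val e) t a -> name_val (nmTerm (tterm t) e) = a.
Proof.
move=> ta; have [] := @pick_valP
    (fun a => exists2 T, tterm t = tterm T & denotes (env_val e) T a).
  by exists a; exists t.
by move=> r /tterm_inj <- tb; apply: denotes_fun tb ta.
Qed.

(** Rank [0] belongs to the names of terms, so the kinds of witness start at 1, whence [k.+1]. *)
Lemma name_val_wit k x phi e (n := nmWit k.+1 (ntree x) (tform phi) e) :
  (exists a, witness_prop k.+1 (upd (env_val e) x a) phi) ->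
  witness_prop k.+1 (upd (env_val e) x (name_val n)) phi.
Proof.
move=> [a aP].
have -> : name_val n = pick_val (fun a => exists2 psi, tform phi = tform psi
    & witness_prop k.+1 (upd (env_val e) x a) psi).
  by rewrite /n /= rank_mark ntreeK.
have [|psi /tform_inj <- //] := @pick_valP (fun a => exists2 psi, tform phi = tform psi
    & witness_prop k.+1 (upd (env_val e) x a) psi).
by exists a; exists phi.
Qed.

Lemma atom_val_eq a b : atom_val (atEq a b) = (name_val a = name_val b).
Proof. by []. Qed.

Fixpoint cong_val l e l' e' :=
  match l, l' with
  | N t m, N t' m' =>
      [/\ atom_val (atDef t' e'), name_val (nmTerm t e) = name_val (nmTerm t' e')
        & cong_val m e m' e']
  | L, L => True
  | _, _ => False
  end.

End Interpretation.

Section Soundness.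

Variable S : signature.

(** The invariant of derivations, by the tag of the fact. Refutations and conflicts speak of all
    structures and base valuations; the syntactic facts recover actual terms and formulas from
    trees. *)
Definition fact_val (x : tree) : Prop :=
  match x with
  | N tg args =>
      match rank tg, args with
      | 0, t => exists T : term S, t = tterm T
      | 1, N k l => exists2 s : seq (term S), tnat k = size s & l = lst (map (@tterm S) s)
      | 2, p => exists phi : formula S, p = tform phi
      | 3, l => exists s : seq (formula S), l = lst (map (@tform S) s)
      | 4, N x l => tin x l
      | 5, N l l' => forall x, tin x l -> tin x l'
      | 6, l => forall (A : algebra S) (s0 : nat -> A),
          ~ forall x, tin x l -> lit_val s0 x
      | 7, l => forall (A : algebra S) (s0 : nat -> A), refutes (lit_val s0) l
      | 8, N l (N e c) => forall (A : algebra S) (s0 : nat -> A),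
          (forall x, tin x c -> lit_val s0 x) ->
          forall t, tin t l -> atom_val s0 (atDef t e)
      | 9, N l (N e (N l' (N e' c))) => forall (A : algebra S) (s0 : nat -> A),
          (forall x, tin x c -> lit_val s0 x) -> cong_val s0 l e l' e'
      | 10, N p l => exists phi (Gamma : seq (formula S)),
          [/\ p = tform phi, l = lst (map (@tform S) Gamma) & consequence Gamma phi]
      | _, _ => False
      end
  | L => False
  end.

Definition rule_sound r := forall w,
  all_of (guard_ok w) (guards r) -> all_of (fun p => fact_val (inst w p)) (prems r) ->
  fact_val (inst w (concl r)).

Local Arguments atom_val : simpl never.
Local Arguments name_val : simpl never.
Local Arguments lit_val _ _ _ !l /.

Ltac next_rule := split; [intro; lazymatch goal with w : seq tree |- _ =>
  rewrite /guard_ok /=;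
  move: (nth L w 0) (nth L w 1) (nth L w 2) (nth L w 3) (nth L w 4) (nth L w 5)
        (nth L w 6) => x0 x1 x2 x3 x4 x5 x6 end |].

Lemma syntax_rules_sound : all_of rule_sound (syntax_rules S).
Proof.
next_rule; first by exists (Var (tnat x0)); rewrite /= tnatK.
next_rule.
  rewrite /const_guard; case E: (pickle_inv _) => [c|] [] // _ _ _.
  exists (Const c); have := @pickle_invK (const_sym S) (tnat x0).
  by rewrite E /= => ->; rewrite tnatK.
next_rule.
  rewrite /arity_guard => -[Ear _] [[s Esz ->] _]; move: Ear.
  (* The arity equals the number of a [node], hence is positive, while a number that is no symbol
     would give [0]. *)
  case E: (pickle_inv _) => [f|]; last first.
    by move=> E0; have := cpair_gt0 (tnat x2) (tnat x3); rewrite -E0.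
  have := @pickle_invK (fun_sym S) (tnat x0); rewrite E /= Esz => fx0 Es.
  exists (App f (fun i => nth (Var 0) s i)); rewrite /= fx0 tnatK.
  congr cApp; congr lst; rewrite -[in LHS](mkseq_nth (Var 0) s) -Es.
  by rewrite /mkseq -(val_enum_ord (arity f)) -!map_comp.
next_rule; first by exists [::].
next_rule.
  move=> [Ek _] [[T ->] [[s Es ->] _]]; exists (T :: s) => //=.
  by rewrite -Ek Es.
next_rule; first by exists Tr.
next_rule; first by exists Fa.
next_rule; first by move=> _ [[t ->] [[r ->] _]]; exists (Eqp t r).
next_rule; first by move=> _ [[p ->] _]; exists (Neg p).
next_rule; first by move=> _ [[p ->] [[q ->] _]]; exists (Orl p q).
next_rule; first by move=> _ [[p ->] _]; exists (Allp (tnat x0) p); rewrite /= tnatK.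
next_rule; first by exists [::].
next_rule; first by move=> _ [[p ->] [[s ->] _]]; exists (p :: s).
by [].
Qed.

Lemma refutation_rules_sound : all_of rule_sound refutation_rules.
Proof.
next_rule; first by left.
next_rule; first by move=> _ [x0x2 _]; right.
next_rule; first by [].
next_rule; first by move=> _ [m [s _]] y [->|/s].
next_rule.
  move=> _ [c [s _]] A s0 all; have /refutesP := c A s0; apply.
  by move=> x /s; apply: all.
next_rule.
  move=> _ [c [d _]] A s0 all.
  have [ax1|nax1] := pselect (atom_val s0 x1).
    by apply: (c A s0) => x [->|/all].
  by apply: (d A s0) => x [->|/all].
next_rule; last by [].
move=> _ [[phi ->] [[Gamma ->] [ref _]]]; exists phi, Gamma; split=> // A GammaP s0.
(* The negated conclusion is evaluated in the empty environment, that is at [s0], which is an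
   arbitrary valuation here. *)
apply: contrapT => nphi; apply: (ref A s0) => x [->|].
  by rewrite /= (atom_val_sat s0 phi).
elim: Gamma GammaP {ref} => //= psi Gamma IH GammaP [->|].
  by apply/lit_val_form => s; apply: (GammaP s 0).
by apply: IH => s i; apply: (GammaP s i.+1).
Qed.

Lemma formula_rules_sound : all_of rule_sound formula_rules.
Proof.
next_rule; first by move=> _ _ A s0; rewrite (atom_val_sat s0 Tr); apply.
next_rule; first by move=> _ _ A s0; rewrite (atom_val_deny s0 Tr).
next_rule; first by move=> _ _ A s0; rewrite (atom_val_sat s0 Fa).
next_rule; first by move=> _ _ A s0; rewrite (atom_val_deny s0 Fa); apply.
next_rule.
  move=> _ [[t ->] [[r ->] _]] A s0.
  by rewrite (atom_val_sat s0 (Eqp t r)) atom_val_def => -[a [ta _]]; apply; exists a.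
next_rule.
  move=> _ [[t ->] [[r ->] _]] A s0.
  by rewrite (atom_val_sat s0 (Eqp t r)) atom_val_def => -[a [_ ra]]; apply; exists a.
next_rule.
  move=> _ [[t ->] [[r ->] _]] A s0; rewrite (atom_val_sat s0 (Eqp t r)) atom_val_eq.
  by move=> [a [/name_val_term ta /name_val_term ra]]; rewrite ta ra; apply.
next_rule.
  move=> _ [[t ->] [[r ->] _]] A s0.
  rewrite !atom_val_def (atom_val_sat s0 (Eqp t r)) atom_val_eq => -[a ta] [b rb].
  rewrite (name_val_term ta) (name_val_term rb) => Eab; apply.
  by exists a; rewrite {2}Eab.
next_rule.
  move=> _ [[t ->] [[r ->] _]] A s0.
  rewrite (atom_val_deny s0 (Eqp t r)) atom_val_def => -[a [b [ta _ _]]].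
  by apply; exists a.
next_rule.
  move=> _ [[t ->] [[r ->] _]] A s0.
  rewrite (atom_val_deny s0 (Eqp t r)) atom_val_def => -[a [b [_ rb _]]].
  by apply; exists b.
next_rule.
  move=> _ [[t ->] [[r ->] _]] A s0; rewrite (atom_val_deny s0 (Eqp t r)) atom_val_eq.
  by move=> [a [b [/name_val_term -> /name_val_term ->]]].
next_rule.
  move=> _ [[t ->] [[r ->] _]] A s0.
  rewrite !atom_val_def (atom_val_deny s0 (Eqp t r)) atom_val_eq => -[a ta] [b rb].
  by rewrite (name_val_term ta) (name_val_term rb) => nab; apply; exists a, b.
next_rule.
  move=> _ [[p ->] _] A s0.
  by rewrite (atom_val_sat s0 (Neg p)) atom_val_deny => ?; apply.
next_rule.
  move=> _ [[p ->] _] A s0.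
  by rewrite (atom_val_sat s0 (Neg p)) atom_val_deny => ?; apply.
next_rule.
  move=> _ [[p ->] _] A s0.
  by rewrite (atom_val_deny s0 (Neg p)) atom_val_sat => ?; apply.
next_rule.
  move=> _ [[p ->] _] A s0.
  by rewrite (atom_val_deny s0 (Neg p)) atom_val_sat => ?; apply.
do 4! [next_rule; first by
  move=> _ [[p ->] [[q ->] _]] A s0;
  rewrite (atom_val_sat s0 (Orl p q)) ?atom_val_sat ?atom_val_deny /=; tauto].
do 3! [next_rule; first by
  move=> _ [[p ->] [[q ->] _]] A s0;
  rewrite (atom_val_deny s0 (Orl p q)) ?atom_val_deny /=; tauto].
next_rule.
  move=> _ [[p ->] _] A s0; rewrite -(tnatK x0); move: (tnat x0) => x.
  rewrite (atom_val_sat s0 (Allp x p)) atom_val_sat /= ntreeK.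
  by move=> all; apply; apply: all.
next_rule.
  move=> _ [[p ->] _] A s0; rewrite -(tnatK x0); move: (tnat x0) => x.
  rewrite (atom_val_sat s0 (Allp x p)) atom_val_sat /= ntreeK.
  move=> pw; apply=> a /=; apply: contrapT => npa.
  by apply: (@name_val_wit _ _ s0 0 x p x2) pw; exists a.
next_rule.
  move=> _ [[p ->] _] A s0; rewrite -(tnatK x0); move: (tnat x0) => x.
  rewrite (atom_val_deny s0 (Allp x p)) atom_val_deny /= ntreeK.
  move=> [exa _]; apply.
  exact: (@name_val_wit _ _ s0 1 x p x2).
next_rule.
  move=> _ [[p ->] _] A s0; rewrite -(tnatK x0); move: (tnat x0) => x.
  rewrite (atom_val_deny s0 (Allp x p)) atom_val_deny atom_val_sat /= ntreeK.
  by move=> [_ /(_ (name_val s0 x3))]; tauto.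
next_rule.
  move=> _ [[p ->] _] A s0; rewrite -(tnatK x0); move: (tnat x0) => x.
  rewrite (atom_val_deny s0 (Allp x p)) atom_val_deny atom_val_sat /= ntreeK.
  move=> pa pw; apply; split; first by exists (name_val s0 x3).
  move=> b; apply: contrapT => nb.
  (* If the body were undecided at [b], it would be undecided at the witness, against [pw]. *)
  have [|nw _] := @name_val_wit _ _ s0 2 x p x2; last exact: nw pw.
  by exists b; split=> ?; apply: nb; auto.
next_rule.
  move=> _ [[p ->] _] A s0; rewrite -(tnatK x0); move: (tnat x0) => x.
  rewrite (atom_val_deny s0 (Allp x p)) !atom_val_deny /= ntreeK.
  move=> pa pw; apply; split; first by exists (name_val s0 x3).
  move=> b; apply: contrapT => nb.
  have [|_ nw] := @name_val_wit _ _ s0 2 x p x2; last exact: nw pw.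
  by exists b; split=> ?; apply: nb; auto.
next_rule; last by [].
move=> _ [[p ->] _] A s0 /lit_val_form pP; rewrite atom_val_sat; apply; exact: pP.
Qed.

Lemma tterm_App x l (T : term S) : cApp x l = tterm T ->
  exists f (ts : 'I_(arity f) -> term S),
    [/\ T = App f ts, x = ntree (pickle f)
      & l = lst [seq tterm (ts i) | i <- enum 'I_(arity f)] ].
Proof. by case: T => [y|c|f ts] //= [-> ->]; exists f, ts. Qed.

Lemma tin_lst (I : eqType) (F : I -> tree) s t :
  tin t (lst (map F s)) <-> exists2 i, i \in s & t = F i.
Proof.
elim: s => [|i s IHs] /=; first by split=> // -[].
split=> [[->|/IHs[j js ->]]|[j]]; first by exists i; rewrite ?mem_head.
  by exists j; rewrite // inE js orbT.
by rewrite inE => /predU1P[->|js] E; [left | right; apply/IHs; exists j].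
Qed.

Lemma tin_args (f : fun_sym S) (ts : 'I_(arity f) -> term S) t :
  tin t (lst [seq tterm (ts i) | i <- enum 'I_(arity f)]) <-> exists i, t = tterm (ts i).
Proof.
split=> [/tin_lst[i _ ->]|[i ->]]; first by exists i.
by apply/tin_lst; exists i; rewrite ?mem_enum.
Qed.

Lemma const_guardP x : const_guard S (tnat x) = 1 ->
  exists c : const_sym S, x = ntree (pickle c).
Proof.
rewrite /const_guard; case E: (pickle_inv _) => [c|] // _; exists c.
by have := @pickle_invK (const_sym S) (tnat x); rewrite E /= => ->; rewrite tnatK.
Qed.

Lemma denotes_cong (A : algebra S) (s0 : nat -> A) (f : fun_sym S)
    (ts ts' : 'I_(arity f) -> term S) e e' a :
  cong_val s0 (lst [seq tterm (ts i) | i <- enum 'I_(arity f)]) e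
              (lst [seq tterm (ts' i) | i <- enum 'I_(arity f)]) e' ->
  denotes (env_val s0 e) (App f ts) a -> denotes (env_val s0 e') (App f ts') a.
Proof.
(* One tuple of values serves both applications, since equal names of defined terms denote equal
   values. *)
move=> cong [v [vP fv]]; exists v; split=> // i.
have: i \in enum 'I_(arity f) by rewrite mem_enum.
elim: (enum _) cong => //= j s IHs [].
rewrite atom_val_def => -[b tb]; rewrite (name_val_term tb) (name_val_term (vP j)) => vb.
by move=> /IHs{}IHs; rewrite inE => /predU1P[->|/IHs //]; rewrite vb.
Qed.

Lemma term_rules_sound : all_of rule_sound (term_rules S).
Proof.
next_rule; first by move=> _ _ A s0 a; apply.
next_rule; first by move=> _ _ A s0; rewrite atom_val_eq; apply.
next_rule; first by move=> _ _ A s0; rewrite !atom_val_eq => -> ->; apply.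
next_rule.
  move=> _ _ A s0; rewrite -(tnatK x0) (atom_val_def s0 (Var (tnat x0))).
  by apply; exists (env_val s0 x1 (tnat x0)).
next_rule.
  move=> _ _ A s0; rewrite -(tnatK x0) atom_val_eq; apply.
  by apply: (@name_val_term _ _ _ (Var (tnat x0))); rewrite /= ntreeK /upd eqxx.
next_rule.
  rewrite /neq_guard chead_pair ctail_pair => -[+ _] _ A s0.
  case: eqVneq => // neq _; rewrite -(tnatK x0) atom_val_eq; apply.
  apply: (@name_val_term _ _ _ (Var (tnat x0))); rewrite /= /upd (negPf neq).
  by apply/esym; apply: (@name_val_term _ _ _ (Var (tnat x0))).
next_rule.
  move=> [/const_guardP[c ->] _] _ A s0; rewrite (atom_val_def s0 (Const c)); apply.
  by exists (const_val A c).
next_rule.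
  move=> [/const_guardP[c ->] _] _ A s0; rewrite atom_val_eq; apply.
  have nmc e : name_val s0 (nmTerm (tterm (Const c)) e) = const_val A c.
    exact: name_val_term.
  exact: etrans (nmc x1) (esym (nmc x2)).
next_rule.
  move=> _ [[_ /tterm_App[f [ts [_ -> ->]]]] [/tin_args[i ->] _]] A s0.
  rewrite (atom_val_def s0 (App f ts)) atom_val_def => -[a [v [vP _]]]; apply.
  by exists (tnth v i); apply: vP.
next_rule; first by [].
next_rule.
  move=> _ [defs _] A s0 all t [->|/defs]; first exact: (all _ (or_introl erefl)).
  by apply=> x xx3; apply: all; right.
next_rule.
  move=> [tot _] [[_ /tterm_App[f [ts [_ Ef ->]]]] [defs _]] A s0 /= ndef.
  apply/refutesP => /defs{}defs; apply: ndef.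
  rewrite Ef (atom_val_def s0 (App f ts)).
  have /choice[g gP] : forall i, exists a, denotes (env_val s0 x2) (ts i) a.
    by move=> i; rewrite -atom_val_def; apply: defs; apply/tin_args; exists i.
  have ftot : is_total f.
    by move: tot; rewrite Ef ntreeK /total_guard pickleK_inv; case: is_total.
  have := @fun_val_total _ A f [tuple g i | i < arity f] ftot.
  case Ev: (fun_val _) => [a|] // _; exists a, [tuple g i | i < arity f]; split=> // i.
  by rewrite tnth_mktuple.
next_rule; first by [].
next_rule.
  move=> _ [cong _] A s0 all; split; first by apply: (all _ (or_introl erefl)).
    by apply: (all _ (or_intror (or_introl erefl))).
  by apply: cong => x xx6; apply: all; right; right.
next_rule.
  move=> _ [[_ /tterm_App[f [ts [_ -> ->]]]]
    [[_ /tterm_App[f' [ts' [_ + ->]]]] [cong _]]] A s0 /=.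
  move=> /(can_inj ntreeK)/(pcan_inj pickleK) Ef; case: f' / Ef ts' cong => ts' cong.
  rewrite (atom_val_def s0 (App f ts)) (atom_val_def s0 (App f ts')) => ndef [a aP].
  by apply/refutesP => /cong /denotes_cong/(_ aP) ?; apply: ndef; exists a.
next_rule; last by [].
move=> _ [[_ /tterm_App[f [ts [_ -> ->]]]]
    [[_ /tterm_App[f' [ts' [_ + ->]]]] [cong _]]] A s0 /=.
move=> /(can_inj ntreeK)/(pcan_inj pickleK) Ef; case: f' / Ef ts' cong => ts' cong.
rewrite (atom_val_def s0 (App f ts)) => neq [a aP].
apply/refutesP => /cong /denotes_cong/(_ aP) bP; apply: neq.
exact: etrans (name_val_term aP) (esym (name_val_term bP)).
Qed.

Lemma all_of_cat T (P : T -> Prop) s s' : all_of P s -> all_of P s' -> all_of P (s ++ s').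
Proof. by elim: s => //= x s IHs [Px /IHs Ps] /Ps. Qed.

Lemma program_sound t : derivable (program S) t -> fact_val t.
Proof.
elim=> {t} r w rP gP _ IH; suff /all_ofP/(_ r rP) : all_of rule_sound (program S).
  by apply=> //; apply/all_ofP.
apply: all_of_cat syntax_rules_sound _; apply: all_of_cat refutation_rules_sound _.
exact: all_of_cat formula_rules_sound term_rules_sound.
Qed.

End Soundness.

(** * Derivability of syntactic facts *)

Section Coincidence.

Variable S : signature.

Lemma denotes_agree (t : term S) : exists n, forall (A : algebra S) (s s' : nat -> A),
  (forall x, x < n -> s x = s' x) -> forall a, denotes s t a -> denotes s' t a.
Proof.
elim: t => [x|c|f ts IHts].
- by exists x.+1 => A s s' /(_ x (ltnSn x)) /= ->.
- by exists 0.
have /choice[n nP] := IHts.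
exists (\max_i n i) => A s s' agree a /= [v [vP fv]]; exists v; split=> // i.
apply: nP (vP i) => x ltx; apply: agree; apply: leq_trans ltx _.
exact: leq_bigmax.
Qed.

(** The bound depends on the formula alone, so a finite environment can stand for a valuation. As
    the hypothesis is symmetric, implications suffice. *)
Lemma sat_agree (phi : formula S) : exists n, forall (A : algebra S) (s s' : nat -> A),
  (forall x, x < n -> s x = s' x) ->
  (sat s phi -> sat s' phi) /\ (deny s phi -> deny s' phi).
Proof.
elim: phi => [||t r|phi [n nP]|phi [n nP] psi [m mP]|x phi [n nP]]; try by exists 0.
- have [[n nP] [m mP]] := (denotes_agree t, denotes_agree r).
  exists (maxn n m) => A s s' agree.
  have tP := nP A s s' (fun x ltx => agree x (leq_trans ltx (leq_maxl n m))).
  have rP := mP A s s' (fun x ltx => agree x (leq_trans ltx (leq_maxr n m))).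
  by split=> [[a [/tP ta /rP ra]]|[a [b [/tP ta /rP rb nab]]]]; [exists a | exists a, b].
- by exists n => A s s' /nP[].
- exists (maxn n m) => A s s' agree /=.
  have [] := nP A s s' (fun x ltx => agree x (leq_trans ltx (leq_maxl n m))).
  have [] := mP A s s' (fun x ltx => agree x (leq_trans ltx (leq_maxr n m))).
  by tauto.
exists n => A s s' agree /=.
have updP a : _ := nP A (upd s x a) (upd s' x a) _.
have {}updP a : (sat (upd s x a) phi -> sat (upd s' x a) phi) /\
    (deny (upd s x a) phi -> deny (upd s' x a) phi).
  by apply: updP => y lty; rewrite /upd; case: eqP => // _; apply: agree.
split=> [all a|[[a ap] all]]; first exact: (updP a).1.
split=> [|b]; first by exists a; apply: (updP a).2.
by have [] := updP b; case: (all b); tauto.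
Qed.

End Coincidence.

(** * Building derivations in the program *)

Section Derivations.

Variable S : signature.
Let prog := program S.
Local Notation der := (derivable prog).

Definition rule0 := Rule leaf [::] [::].

Lemma In_nth (rs : seq rule) i : i < size rs -> List.In (nth rule0 rs i) rs.
Proof. by elim: rs i => //= r rs IHrs [|i] lti; [left | right; apply: IHrs]. Qed.

Lemma In_cat T (x : T) s s' : List.In x s \/ List.In x s' -> List.In x (s ++ s').
Proof. by elim: s => [|y s IHs] /= [] //; [case; auto | auto]. Qed.

(** Rules are applied by their position in the list, with the instance given as a list; entries
    beyond its end are [L]. *)
Definition applies rs := forall i w, i < size rs -> let r := nth rule0 rs i in
  all_of (guard_ok w) (guards r) -> all_of (fun p => der (inst w p)) (prems r) ->
  der (inst w (concl r)).

Lemma appliesP rs : (forall r, List.In r rs -> List.In r prog) -> applies rs.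
Proof.
move=> subP i w lti r gs /all_ofP ps; apply: Derivable => //.
by apply: subP; apply: In_nth.
Qed.

Lemma syntax_applies : applies (syntax_rules S).
Proof. by apply: appliesP => r rP; do ?[apply: In_cat; auto; right]. Qed.

Lemma refutation_applies : applies refutation_rules.
Proof. by apply: appliesP => r rP; do ?[apply: In_cat; auto; right]. Qed.

Lemma formula_applies : applies formula_rules.
Proof. by apply: appliesP => r rP; do ?[apply: In_cat; auto; right]. Qed.

Lemma term_applies : applies (term_rules S).
Proof. by apply: appliesP => r rP; do ?[apply: In_cat; auto; right]. Qed.

Lemma der_terms (s : seq (term S)) :
  (forall t, List.In t s -> der (isTerm (tterm t))) ->
  der (isTerms (ntree (size s)) (lst (map (@tterm S) s))).
Proof.
elim: s => [|t s IHs] sP; first exact: (@syntax_applies 3 [::]).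
apply: (@syntax_applies 4 [:: ntree (size s).+1; tterm t; _; ntree (size s)]) => //.
  by split=> //; apply: etrans (congr1 succn (ntreeK _)) (esym (ntreeK (size s).+1)).
by split; [apply: sP; left | split=> //; apply: IHs => r rs; apply: sP; right].
Qed.

Lemma der_term (t : term S) : der (isTerm (tterm t)).
Proof.
elim: t => [x|c|f ts IHts]; first exact: (@syntax_applies 0 [:: ntree x]).
  apply: (@syntax_applies 1 [:: ntree (pickle c)]) => //.
  by split=> //; rewrite /guard_ok /const_guard /= ntreeK pickleK_inv.
have := @der_terms (map ts (enum 'I_(arity f))); rewrite -map_comp size_map size_enum_ord.
have := ntreeK (arity f); case: (ntree (arity f)) => [|a b] Ear.
  by exfalso; have := arity_gt0 f; rewrite -Ear.
move=> /(_ _) dts; apply: (@syntax_applies 2 [:: ntree (pickle f); _; a; b]) => //.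
  by split=> //; rewrite /guard_ok /arity_guard [LHS]/= ntreeK pickleK_inv.
split=> //; apply: dts => t.
by elim: (enum _) => [|i s IHs] [] // <-; apply: IHts.
Qed.

Lemma der_form (phi : formula S) : der (isForm (tform phi)).
Proof.
elim: phi => [||t r|phi IH|phi IH psi IH'|x phi IH].
- exact: (@syntax_applies 5 [::]).
- exact: (@syntax_applies 6 [::]).
- by apply: (@syntax_applies 7 [:: _; _]) => //; split; [|split=> //]; apply: der_term.
- exact: (@syntax_applies 8 [:: _]).
- exact: (@syntax_applies 9 [:: _; _]).
- exact: (@syntax_applies 10 [:: _; _]).
Qed.

Lemma der_forms (s : seq (formula S)) : der (isForms (lst (map (@tform S) s))).
Proof.
elim: s => [|phi s IHs]; first exact: (@syntax_applies 11 [::]).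
by apply: (@syntax_applies 12 [:: _; _]) => //; split=> //; apply: der_form.
Qed.

Lemma der_mem x l : tin x l -> der (isMem x l).
Proof.
elim: l => //= y _ l IHl [->|/IHl xl]; first exact: (@refutation_applies 0 [:: y; l]).
exact: (@refutation_applies 1 [:: x; y; l]).
Qed.

Lemma der_sub l l' : (forall x, tin x l -> tin x l') -> der (isIncl l l').
Proof.
elim: l => [|x _ l IHl] subP; first exact: (@refutation_applies 2 [:: l']).
apply: (@refutation_applies 3 [:: x; l; l']) => //.
split; first by apply: der_mem; apply: subP; left.
by split=> //; apply: IHl => y yl; apply: subP; right.
Qed.

End Derivations.

(** * The model of a consistent valuation *)

Section TermModel.

Variables (S : signature) (V : tree -> bool) (H : tree -> Prop).

(** The two patterns are [mark 3] and [mark 4]. Other literals, in particular codes of formulas, are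
    left to [H]. *)
Definition lit_true l :=
  match l with
  | N (N L (N L (N L L))) a => V a : Prop
  | N (N L (N L (N L (N L L)))) a => ~~ V a
  | _ => H l
  end.

Hypothesis consistent :
  forall l, derivable (program S) (isConflict l) -> refutes lit_true l.

(** The equation on the conclusion is closed by [erefl], after which the [i]-th rule becomes a
    clause about [V] by computation. *)
Lemma formula_conflict i w : i < size formula_rules ->
  let r := nth rule0 formula_rules i in
  all_of (guard_ok w) (guards r) ->
  all_of (fun p => derivable (program S) (inst w p)) (prems r) ->
  forall l, inst w (concl r) = isConflict l -> refutes lit_true l.
Proof.
by move=> lti r gs ps l E; apply: consistent; rewrite -E; apply: formula_applies.
Qed.

Lemma term_conflict i w : i < size (term_rules S) ->
  let r := nth rule0 (term_rules S) i in
  all_of (guard_ok w) (guards r) ->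
  all_of (fun p => derivable (program S) (inst w p)) (prems r) ->
  forall l, inst w (concl r) = isConflict l -> refutes lit_true l.
Proof.
by move=> lti r gs ps l E; apply: consistent; rewrite -E; apply: term_applies.
Qed.

Definition sameN a b := V (atEq a b).

Lemma sameN_refl a : sameN a a.
Proof.
have /= := @term_conflict 1 [:: a] isT I I _ erefl.
by rewrite /sameN /=; case: (V _) => // /(_ isT).
Qed.

Lemma sameN_euclid a b c : sameN a b -> sameN a c -> sameN b c.
Proof.
have /= := @term_conflict 2 [:: a; b; c] isT I I _ erefl.
by rewrite /sameN /=; case: (V _) => // ab /ab{}ab /ab; case: (V _) => // /(_ isT).
Qed.

Lemma sameN_sym a b : sameN a b -> sameN b a.
Proof. by move=> ab; apply: sameN_euclid ab (sameN_refl a). Qed.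

Lemma sameN_trans a b c : sameN a b -> sameN b c -> sameN a c.
Proof. by move=> /sameN_sym; apply: sameN_euclid. Qed.

(** The quotient of all trees by [sameN], a class being given by its characteristic function. *)
Definition name_class := {P : tree -> bool | exists a, P = sameN a}.

Definition class_of a : name_class := exist _ (sameN a) (ex_intro _ a erefl).
Definition class_repr (d : name_class) : tree := sval (cid (svalP d)).

Lemma class_ext (d d' : name_class) : sval d = sval d' -> d = d'.
Proof.
case: d d' => [P p] [Q q] /= E; case: Q / E q => q.
by congr exist; apply: Prop_irrelevance.
Qed.

Lemma class_eq a b : (class_of a = class_of b) <-> sameN a b.
Proof.
split=> [/(congr1 sval) /= ->|ab]; first exact: sameN_refl.
apply: class_ext => /=; apply/funext => c.
by apply/idP/idP; [apply: sameN_euclid | apply: sameN_trans].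
Qed.

Lemma class_reprK d : class_of (class_repr d) = d.
Proof. by apply: class_ext => /=; rewrite /class_repr; case: cid => /= a ->. Qed.

Fixpoint bindings i s := if s is a :: s' then bind (ntree i) a (bindings i.+1 s') else L.

Lemma sameN_bind x a e : sameN (nmTerm (cVar (ntree x)) (bind (ntree x) a e)) a.
Proof.
have /= := @term_conflict 4 [:: ntree x; a; e] isT I I _ erefl.
by rewrite /sameN /=; case: (V _) => // /(_ isT).
Qed.

Lemma sameN_bind_neq x y a e : x != y ->
  sameN (nmTerm (cVar (ntree x)) (bind (ntree y) a e)) (nmTerm (cVar (ntree x)) e).
Proof.
move=> xy; have g : all_of (guard_ok [:: ntree x; a; e; ntree y])
    [:: (neq_guard, node v0 v3, num1)].
  by split=> //; rewrite /guard_ok /neq_guard /= chead_pair ctail_pair !ntreeK xy.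
have /= := @term_conflict 5 [:: ntree x; a; e; ntree y] isT g I _ erefl.
by rewrite /sameN /=; case: (V _) => // /(_ isT).
Qed.

Lemma sameN_bindings i s j : j < size s ->
  sameN (nmTerm (cVar (ntree (i + j))) (bindings i s)) (nth L s j).
Proof.
elim: s i j => //= a s IHs i [_|j ltj]; first by rewrite addn0; apply: sameN_bind.
apply: sameN_trans (sameN_bind_neq _ _ _) _.
  by rewrite -[X in _ != X]addn0 eqn_add2l.
by rewrite addnS -addSn; apply: IHs.
Qed.

Lemma def_var x e : V (atDef (cVar x) e).
Proof.
have /= := @term_conflict 3 [:: x; e] isT I I _ erefl.
by case: (V _) => // /(_ isT).
Qed.

Lemma const_guard_ok (c : const_sym S) w :
  nth L w 0 = ntree (pickle c) -> all_of (guard_ok w) [:: (const_guard S, v0, num1)].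
Proof.
by move=> E; split=> //; rewrite /guard_ok /const_guard /= E ntreeK pickleK_inv.
Qed.

Lemma def_const (c : const_sym S) e : V (atDef (tterm (Const c)) e).
Proof.
have g := @const_guard_ok c [:: ntree (pickle c); e] erefl.
have /= := @term_conflict 6 _ isT g I _ erefl.
by case: (V _) => // /(_ isT).
Qed.

Lemma sameN_const (c : const_sym S) e e' :
  sameN (nmTerm (tterm (Const c)) e) (nmTerm (tterm (Const c)) e').
Proof.
have g := @const_guard_ok c [:: ntree (pickle c); e; e'] erefl.
have /= := @term_conflict 7 _ isT g I _ erefl.
by rewrite /sameN /=; case: (V _) => // /(_ isT).
Qed.

Section Application.

Variables (f : fun_sym S) (ts : 'I_(arity f) -> term S) (e : tree).

Lemma def_arg i : V (atDef (tterm (App f ts)) e) -> V (atDef (tterm (ts i)) e).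
Proof.
have ps : all_of (fun p => derivable (program S) (inst [:: ntree (pickle f);
    lst [seq tterm (ts i) | i <- enum 'I_(arity f)]; e; tterm (ts i)] p))
    [:: isTerm (cApp v0 v1); isMem v3 v1].
  by split; [apply: (der_term (App f ts)) | split=> //; apply/der_mem/tin_args; exists i].
have /= := @term_conflict 8 _ isT I ps _ erefl.
by case: (V _) => // /(_ isT); case: (V _) => // /(_ isT).
Qed.

Lemma def_total : is_total f -> (forall i, V (atDef (tterm (ts i)) e)) ->
  V (atDef (tterm (App f ts)) e).
Proof.
move=> ftot defs; set l := lst [seq tterm (ts i) | i <- enum 'I_(arity f)].
pose (c := lst [seq pos (atDef (tterm (ts i)) e) | i <- enum 'I_(arity f)]).
have dc : derivable (program S) (isDefs l e c).
  rewrite /l /c; elim: (enum _) => [|i s IHs]; first exact: (@term_applies S 9 [:: e]).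
  by apply: (@term_applies S 10 [:: _; _; _; _]).
apply: contraT => ndef; have: ~ refutes lit_true (N (neg (atDef (tterm (App f ts)) e)) c).
  by move/refutesP; apply=> x [->|/tin_lst[i _ ->]] //=; apply: defs.
case; apply: consistent.
apply: (@term_applies S 11 [:: ntree (pickle f); l; e; c]) => //.
  by split=> //; rewrite /guard_ok /total_guard /= ntreeK pickleK_inv ftot.
by split=> //; apply: (der_term (App f ts)).
Qed.

Lemma app_cong (ts' : 'I_(arity f) -> term S) e' :
  (forall i, V (atDef (tterm (ts' i)) e')) ->
  (forall i, sameN (nmTerm (tterm (ts i)) e) (nmTerm (tterm (ts' i)) e')) ->
  V (atDef (tterm (App f ts)) e) ->
  V (atDef (tterm (App f ts')) e') /\
  sameN (nmTerm (tterm (App f ts)) e) (nmTerm (tterm (App f ts')) e').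
Proof.
move=> defs same def; set l := lst [seq tterm (ts i) | i <- enum 'I_(arity f)].
set l' := lst [seq tterm (ts' i) | i <- enum 'I_(arity f)].
pose (D i := pos (atDef (tterm (ts' i)) e')).
pose (E i := pos (atEq (nmTerm (tterm (ts i)) e) (nmTerm (tterm (ts' i)) e'))).
pose (c := foldr (fun i c => N (D i) (N (E i) c)) L (enum 'I_(arity f))).
have dc : derivable (program S) (isCong l e l' e' c).
  rewrite /l /l' /c; elim: (enum _) => [|i s IHs].
    exact: (@term_applies S 12 [:: e; e']).
  by apply: (@term_applies S 13 [:: _; _; _; _; _; _; _]).
have cP x : tin x c -> lit_true x.
  rewrite /c; elim: (enum _) => //= i s IHs [->|[->|/IHs //]].
    exact: defs.
  exact: same.
have ps : all_of (fun p => derivable (program S) 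
      (inst [:: ntree (pickle f); l; e; l'; e'; c] p))
   [:: isTerm (cApp v0 v1); isTerm (cApp v0 v3); isCong v1 v2 v3 v4 v5].
  by split; [apply: (der_term (App f ts)) | split; [apply: (der_term (App f ts')) | ]].
split.
  have := @term_conflict 14 _ isT I ps _ erefl.
  move/refutesP => ref; apply: contraT => ndef; case: ref => x [->|[->|/cP //]] //=.
have := @term_conflict 15 _ isT I ps _ erefl.
move/refutesP => ref; apply: contraT => ndef; case: ref => x [->|[->|/cP //]] //=.
Qed.

End Application.

(** A symbol is applied to classes through one generic term, [f] on the variables [0, 1, ...], in
    the environment binding these to representatives. So no term with classes as arguments has to be
    formed. *)
Definition app_env n (v : n.-tuple name_class) := bindings 0 (map class_repr v).
Definition app_name (f : fun_sym S) := tterm (App f (fun i => Var i)).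

Definition model_fun (f : fun_sym S) (v : (arity f).-tuple name_class) :=
  if V (atDef (app_name f) (app_env v)) then
    Some (class_of (nmTerm (app_name f) (app_env v)))
  else None.

Lemma model_fun_total (f : fun_sym S) v : is_total f -> isSome (@model_fun f v).
Proof.
move=> ftot; rewrite /model_fun /app_name def_total // => i; exact: def_var.
Qed.

Definition model : algebra S :=
  Algebra (inhabits (class_of L)) (fun c => class_of (nmTerm (tterm (Const c)) L))
    model_fun_total.

Definition env_class (e : tree) : nat -> model :=
  fun x => class_of (nmTerm (cVar (ntree x)) e).

Lemma app_env_same (f : fun_sym S) (v : (arity f).-tuple model)
    (ts : 'I_(arity f) -> term S) e i :
  tnth v i = class_of (nmTerm (tterm (ts i)) e) ->
  sameN (nmTerm (cVar (ntree i)) (app_env v)) (nmTerm (tterm (ts i)) e).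
Proof.
rewrite (tnth_nth (class_of L)) => vi.
have lti : i < size (map class_repr v) by rewrite size_map size_tuple.
apply: sameN_trans (sameN_bindings 0 lti) _.
rewrite (nth_map (class_of L)) ?size_tuple //; apply/class_eq.
by rewrite class_reprK.
Qed.

(** At an application, [app_cong] passes between the given term in [e] and the generic term behind
    [model_fun], in either direction. *)
Lemma denotes_model t e a : denotes (env_class e) t a <->
  V (atDef (tterm t) e) /\ a = class_of (nmTerm (tterm t) e).
Proof.
elim: t a => [x|c|f ts IHts] a.
- by split=> [<-|[_ ->]] //; split=> //; apply: def_var.
- split=> [<-|[_ ->]]; last by apply/class_eq; apply: sameN_const.
  by split; [apply: def_const | apply/class_eq; apply: sameN_const].
split=> [[v [vP]]|[def ->]].
  rewrite /= /model_fun; case: ifP => // def [<-].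
  have same i := app_env_same (proj2 ((IHts i _).1 (vP i))).
  have [|def' E] := app_cong (ts := fun i => Var i) (ts' := ts) (e' := e) _ same def.
    by move=> i; apply: (proj1 ((IHts i _).1 (vP i))).
  by split=> //; apply/class_eq.
pose (v := [tuple class_of (nmTerm (tterm (ts i)) e) | i < arity f] :
  (arity f).-tuple model).
have vE i : tnth v i = class_of (nmTerm (tterm (ts i)) e) by rewrite tnth_mktuple.
exists v; split=> [i|]; first by apply/IHts; rewrite vE; split=> //; apply: def_arg def.
have same i : sameN (nmTerm (tterm (ts i)) e) (nmTerm (cVar (ntree i)) (app_env v)).
  exact/sameN_sym/app_env_same.
have [|def' E] := app_cong (ts' := fun i => Var i) _ same def.
  by move=> i; apply: def_var.
by rewrite /= /model_fun def'; congr Some; apply/class_eq/sameN_sym.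
Qed.

(** This takes the place of a substitution lemma in the quantifier case. *)
Lemma upd_env_class e x a :
  upd (env_class e) x (class_of a) = env_class (bind (ntree x) a e).
Proof.
apply/funext => y; rewrite /upd; case: eqVneq => [->|xy]; apply/class_eq/sameN_sym.
  exact: sameN_bind.
exact: sameN_bind_neq.
Qed.

Ltac decide_atoms :=
  repeat match goal with |- context [V ?a] => case: (V a) end;
  rewrite /is_true /=; intuition congruence.

(** The truth lemma, for all environments at once because a quantifier extends the environment. The
    clauses fix both atoms of a formula from those of its parts, and case analysis on truth values
    concludes. *)
Lemma sat_model phi e :
  (sat (env_class e) phi <-> V (atSat (tform phi) e)) /\
  (deny (env_class e) phi <-> V (atDeny (tform phi) e)).
Proof.
elim: phi e => [||t r|phi IH|phi IH psi IH'|x phi IH] e.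
- have conf i := @formula_conflict i [:: L; L; e].
  by move: (conf 0 isT I I _ erefl) (conf 1 isT I I _ erefl) => /=; decide_atoms.
- have conf i := @formula_conflict i [:: L; L; e].
  by move: (conf 2 isT I I _ erefl) (conf 3 isT I I _ erefl) => /=; decide_atoms.
- have ps : all_of (fun p => derivable (program S) (inst [:: tterm t; tterm r; e] p))
      [:: isTerm v0; isTerm v1] by split; [|split=> //]; apply: der_term.
  have conf i := @formula_conflict i [:: tterm t; tterm r; e].
  have -> : sat (env_class e) (Eqp t r) <->
      [&& V (atDef (tterm t) e), V (atDef (tterm r) e)
       & sameN (nmTerm (tterm t) e) (nmTerm (tterm r) e)].
    split=> [[a [/denotes_model[-> ->] /denotes_model[-> /class_eq]]] //|].
    move=> /and3P[dt dr /class_eq E]; exists (class_of (nmTerm (tterm t) e)).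
    by split; apply/denotes_model.
  have -> : deny (env_class e) (Eqp t r) <->
      [&& V (atDef (tterm t) e), V (atDef (tterm r) e)
       & ~~ sameN (nmTerm (tterm t) e) (nmTerm (tterm r) e)].
    split=> [[a [b [/denotes_model[-> ->] /denotes_model[-> ->] nE]]]|].
      by apply/negP => /class_eq.
    move=> /and3P[dt dr /negP nE]; exists (class_of (nmTerm (tterm t) e)).
    exists (class_of (nmTerm (tterm r) e)).
    by split; try apply/denotes_model; last by move/class_eq.
  move: (conf 4 isT I ps _ erefl) (conf 5 isT I ps _ erefl) (conf 6 isT I ps _ erefl)
    (conf 7 isT I ps _ erefl) (conf 8 isT I ps _ erefl) (conf 9 isT I ps _ erefl)
    (conf 10 isT I ps _ erefl) (conf 11 isT I ps _ erefl); rewrite /sameN /=; clear.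
  by decide_atoms.
- have conf i := @formula_conflict i [:: tform phi; L; e].
  have ps := conj (der_form phi) I.
  have [IHs IHd] := IH e; rewrite /= IHs IHd.
  move: (conf 12 isT I ps _ erefl) (conf 13 isT I ps _ erefl) (conf 14 isT I ps _ erefl)
    (conf 15 isT I ps _ erefl) => /=; clear.
  by decide_atoms.
- have ps : all_of (fun p => derivable (program S) (inst [:: tform phi; tform psi; e] p))
      [:: isForm v0; isForm v1] by split; [|split=> //]; apply: der_form.
  have conf i := @formula_conflict i [:: tform phi; tform psi; e].
  have [IHs IHd] := IH e; have [IHs' IHd'] := IH' e; rewrite /= IHs IHd IHs' IHd'.
  move: (conf 16 isT I ps _ erefl) (conf 17 isT I ps _ erefl) (conf 18 isT I ps _ erefl)
    (conf 19 isT I ps _ erefl) (conf 20 isT I ps _ erefl) (conf 21 isT I ps _ erefl)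
    (conf 22 isT I ps _ erefl) => /=; clear.
  by decide_atoms.
have conf a i := @formula_conflict i [:: ntree x; tform phi; e; a].
have ps := conj (der_form phi) I.
have IHs a := proj1 (IH (bind (ntree x) a e)).
have IHd a := proj2 (IH (bind (ntree x) a e)).
(* Each element is the class of a name, so the clauses for arbitrary names reach the whole
   domain. *)
have bindE a : upd (env_class e) x a = env_class (bind (ntree x) (class_repr a) e).
  by rewrite -upd_env_class class_reprK.
pose (w k := nmWit k (ntree x) (tform phi) e).
rewrite /=; split; split.
- move=> all; move: (conf L 24 isT I ps _ erefl) => /=.
  move: (all (class_of (w 1))); rewrite upd_env_class IHs; clear.
  by decide_atoms.
- move=> sV a; rewrite bindE IHs.
  move: sV (conf (class_repr a) 23 isT I ps _ erefl) => /=.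
  by clear; decide_atoms.
(* The body is denied at [a] and decided at the third witness, so one of the two clauses on that
   witness yields denial. *)
- move=> [[a ap] all]; move: ap (all (class_of (w 3))).
  rewrite upd_env_class bindE !IHs !IHd.
  move: (conf (class_repr a) 27 isT I ps _ erefl)
    (conf (class_repr a) 28 isT I ps _ erefl) => /=.
  by clear; decide_atoms.
move=> dV; split.
  exists (class_of (w 2)); rewrite upd_env_class IHd.
  move: dV (conf L 25 isT I ps _ erefl) => /=.
  by clear; decide_atoms.
move=> b; rewrite bindE IHs IHd; move: dV (conf (class_repr b) 26 isT I ps _ erefl) => /=.
by clear; decide_atoms.
Qed.

(** A valuation need not come from an environment, but one that binds finitely many variables to
    representatives agrees with it where [phi] looks. *)
Lemma sat_everywhere phi : H (tform phi) -> forall s : nat -> model, sat s phi.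
Proof.
move=> Hphi s; have [n nP] := sat_agree phi.
pose (e := bindings 0 (mkseq (class_repr \o s) n)).
have agree x : x < n -> env_class e x = s x.
  move=> ltx; rewrite -[RHS]class_reprK; apply/class_eq.
  have := @sameN_bindings 0 (mkseq (class_repr \o s) n) x.
  by rewrite size_mkseq nth_mkseq //; apply.
apply: (proj1 (nP _ _ _ agree)); apply/(proj1 (sat_model phi e)).
have := @formula_conflict 29 [:: tform phi; L; e] isT I (conj (der_form phi) I) _ erefl.
have -> l' : refutes lit_true (N (tform phi) l') = (H (tform phi) -> refutes lit_true l').
  by case: (phi).
by move=> /(_ Hphi) /=; case: (V _) => // /(_ isT).
Qed.

End TermModel.

(** * Completeness *)

Section Extension.

Variables (S : signature) (l0 : tree).

Let refuted l := derivable (program S) (isRefuted l).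

(** Lindenbaum's construction: [ntree] enumerates all trees, and each is decided as an atom,
    whatever its shape. *)
Fixpoint extension n : tree :=
  if n is m.+1 then
    let a := ntree m in let l := extension m in
    if `[< refuted (N (pos a) l) >] then N (neg a) l else N (pos a) l
  else l0.

(** If both extensions by an atom were refuted, the splitting rule would refute the previous
    stage. *)
Lemma extension_unrefuted n : ~ refuted l0 -> ~ refuted (extension n).
Proof.
move=> nref; elim: n => //= n nrefn; case: asboolP => // rpos rneg; apply: nrefn.
exact: (@refutation_applies S 5 [:: extension n; ntree n]).
Qed.

Lemma extension_mono m n x : m <= n -> tin x (extension m) -> tin x (extension n).
Proof.
move=> le_mn xm; rewrite -(subnK le_mn); elim: (n - m) => //= k IHk.
by case: ifP => _; right.
Qed.

Definition in_extension x := exists n, tin x (extension n).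
Definition valuation a := `[< in_extension (pos a) >].

Lemma valuationPn a : ~~ valuation a -> in_extension (neg a).
Proof.
(* Stage [(tnat a).+1] is the one that decides [a]. *)
move=> /asboolPn npos; exists (tnat a).+1 => /=; rewrite tnatK.
case: ifP => E; [by left | case: npos; exists (tnat a).+1 => /=].
by rewrite tnatK E; left.
Qed.

(** Compactness: a conflict is finite and the stages increase, so a conflict within their union lies
    in one stage and refutes it. *)
Lemma extension_conflict l : ~ refuted l0 ->
  derivable (program S) (isConflict l) -> refutes in_extension l.
Proof.
move=> nref conf; apply/refutesP => all.
have [n nP] : exists n, forall x, tin x l -> tin x (extension n).
  elim: l all {conf} => [|x _ l IHl] all; first by exists 0.
  have [n nP] := IHl (fun y yl => all y (or_intror yl)).
  have [m mP] := all x (or_introl erefl).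
  exists (maxn n m) => y [->|/nP].
    exact: extension_mono (leq_maxr n m) mP.
  exact: extension_mono (leq_maxl n m).
apply: (@extension_unrefuted n nref).
apply: (@refutation_applies S 4 [:: extension n; l]) => //.
by split=> //; split=> //; apply: der_sub.
Qed.

Lemma lit_true_extension l : lit_true valuation in_extension l -> in_extension l.
Proof.
rewrite /lit_true; repeat match goal with
  | |- context [match ?x with _ => _ end] => is_var x; destruct x end => //.
  by move/asboolP.
exact: valuationPn.
Qed.

Lemma valuation_consistent l : ~ refuted l0 -> derivable (program S) (isConflict l) ->
  refutes (lit_true valuation in_extension) l.
Proof.
move=> nref /(extension_conflict nref)/refutesP conf; apply/refutesP => all.
by apply: conf => x /all; apply: lit_true_extension.
Qed.

Lemma valuation_neg a : ~ refuted l0 -> in_extension (neg a) -> ~~ valuation a.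
Proof.
move=> nref na; apply/asboolPn => pa.
have conf : derivable (program S) (isConflict (lst [:: pos a; neg a])).
  exact: (@term_applies S 0 [:: a]).
exact: extension_conflict nref conf pa na.
Qed.

End Extension.

Lemma tin_map_nth T (F : T -> tree) x0 s i :
  i < size s -> tin (F (nth x0 s i)) (lst (map F s)).
Proof. by elim: s i => //= x s IHs [|i] lti; [left | right; apply: IHs]. Qed.

(** If [l0] were not refuted, the completed valuation would have a model where the premises hold
    everywhere and [phi] fails in the empty environment. *)
Lemma consequence_derivable S (Gamma : seq (formula S)) phi :
  consequence Gamma phi <->
  derivable (program S) (isConseq (node (tform phi) (lst (map (@tform S) Gamma)))).
Proof.
split=> [conseq|/program_sound[phi' [Gamma' [/tform_inj <- E]]]]; last first.
  suff -> : Gamma' = Gamma by [].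
  by elim: Gamma Gamma' E => [|psi Gamma IH] [|psi' Gamma'] //= [/tform_inj -> /IH ->].
pose (l0 := node (neg (atSat (tform phi) leaf)) (lst (map (@tform S) Gamma))).
have ref : derivable (program S) (isRefuted l0); last first.
  apply: (@refutation_applies S 6 [:: tform phi; lst (map (@tform S) Gamma)]) => //.
  split; first exact: der_form.
  by split; [apply: der_forms | split; first exact: ref].
apply: contrapT => nref; have cons := fun l => @valuation_consistent S l0 l nref.
have inl0 x : tin x l0 -> in_extension S l0 x by exists 0.
have nphi : ~~ valuation S l0 (atSat (tform phi) L).
  by apply: valuation_neg => //; apply: inl0; left.
move/negP: nphi; apply; apply/(sat_model cons phi L).1; apply: conseq.
move=> s i lti; apply: sat_everywhere; apply: inl0; right.
exact: tin_map_nth.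
Qed.

Theorem proposition4p3p6 (S : signature)
  (S_const : exists c : const_sym S, True)
  (S_partial : exists f : fun_sym S, ~~ is_total f)
  (S_eff : effective S) :
  semi_computable (fun n =>
    exists (Gamma : seq (formula S)) (phi : formula S),
      n = code_sequent Gamma phi /\ consequence Gamma phi).
Proof.
have [constP arityP totalP] := S_eff.
have progP : all_of (fun r => all_of (fun g => computable g.1.1) (guards r)) (program S).
  have neqP : computable neq_guard.
    apply/computable_total_rec; apply: total_rec_not; apply: total_rec_eq;
      [apply: (total_rec_fun1 computable_chead)|apply: (total_rec_fun1 computable_ctail)];
      exact: total_rec_nth.
  by do !split; rewrite //=; apply: computable_succ.
(* The code of a sequent is already a tree; pairing it with [mark 10] forms the query [isConseq]. *)
have conseqP : computable (fun n => cpair (tnat (mark 10)) n).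
  apply/computable_total_rec; apply: (total_rec_fun2 computable2_cpair).
    exact: total_rec_const.
  exact: total_rec_nth.
have [p pP] := semi_computable_derivable progP conseqP; exists p => n; rewrite -pP.
have -> : ntree (cpair (tnat (mark 10)) n) = isConseq (ntree n).
  by apply: (canLR tnatK); rewrite /= ntreeK.
split=> [[Gamma [phi [-> conseq]]]|der].
  by rewrite ntree_sequent; apply/consequence_derivable.
(* Soundness also recovers the sequent: a derivable query forces [n] to be the code of formulas. *)
have := program_sound der; case E: (ntree n) => [//|a l].
case=> phi [Gamma [Ea El conseq]]; exists Gamma, phi; split=> //.
by apply: (can_inj ntreeK); rewrite E ntree_sequent Ea El.
Qed.
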